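(* Let $E$ be an elliptic curve over $\mathbb{Q}$ and let $L(s,E)$ be the associated $L$-function. Then the modified zeta function $\zeta_N^{\rm disc}(s)$ of $E$ fulfills the equality $$\frac{\partial_s\zeta_N^{\rm disc}(s)}{\zeta_N^{\rm disc}(s)}=-\zeta(s+1)-\zeta(s)+\frac{L(s+1,E)}{\zeta(2s+1)M(s+1)}$$ where $\zeta(s)$ is the Riemann zeta function and $$M(s)=\prod_{p\in S}(1-p^{1-2s}),$$ $S$ being the finite set of primes of bad reduction for $E$.
   Context: For a prime power $q=p^\ell$, let $N(q,E)$ be the number of points over $\mathbb{F}_q$ (including the point at infinity and, at primes of bad reduction, the singular point) of the reduction modulo $p$ of a minimal Weierstrass equation of $E$ over $\mathbb{Q}_p$. Let $t(n)$ ($n\ge1$) be the unique multiplicative function ($t(1)=1$ and $t(mn)=t(m)t(n)$ for coprime $m,n$) such that $N(q,E)=q+1-t(q)$ for every prime power $q$, and extend $N$ to all integers $n\ge1$ by $N(n,E)=n+1-t(n)$. The modified zeta function $\zeta_N^{\rm disc}(s)$ is defined (up to a multiplicative constant) by $$\frac{\partial_s\zeta_N^{\rm disc}(s)}{\zeta_N^{\rm disc}(s)}=-\sum_{n\ge1}N(n,E)\,n^{-s-1}$$ for $\Re(s)$ large (and by analytic continuation). $L(s,E)=\prod_pL_p(s,E)$ with $L_p(s,E)=\big((1-\alpha_pp^{-s})(1-\bar\alpha_pp^{-s})\big)^{-1}$ for $p$ of good reduction, where $|\alpha_p|=\sqrt p$ and $N(p^\ell,E)=p^\ell+1-\alpha_p^\ell-\bar\alpha_p^\ell$;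 and for $p$ of bad reduction $L_p(s,E)=(1-p^{-s})^{-1}$, $(1+p^{-s})^{-1}$, or $1$ according to whether the reduction is split multiplicative, non-split multiplicative, or additive. *)

(* Defs.v *)
From HB Require Import structures.
From mathcomp Require Import all_boot all_order all_algebra all_field complex.
From mathcomp Require Import all_classical all_reals all_analysis.

Set Implicit Arguments.
Unset Strict Implicit.
Unset Printing Implicit Defensive.

Import Order.TTheory GRing.Theory Num.Theory.
Import numFieldNormedType.Exports.

Local Open Scope classical_set_scope.
Local Open Scope ring_scope.

(* As for 'F_p, the base is made prime by construction, so that the ring
   structures exist for every index; prime_base p is p when p is prime. *)
Definition prime_base (p : nat) : nat := pdiv (maxn p 2).

Lemma prime_base_prime p : prime (prime_base p).
Proof. by apply: pdiv_prime; rewrite leq_max orbT. Qed.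

Lemma prime_baseE p : prime p -> prime_base p = p.
Proof.
by move=> pp; rewrite /prime_base (maxn_idPl (prime_gt1 pp)) pdiv_id.
Qed.

(* Z_p as the inverse limit of the rings Z/p^n: the n-th term is the residue
   mod p^n in {0, ..., p^n - 1}; the term of index 0 is 0. *)
Record padic_int (p : nat) : Type := PadicInt {
  residue :> nat -> nat;
  residue_mod : forall n, (residue n.+1 %% prime_base p ^ n)%N = residue n }.

Section PadicRing.
Variable p : nat.
Local Notation q := (prime_base p).
Implicit Types x y z : padic_int p.

Lemma padic_inj x y : (forall n, x n = y n) -> x = y.
Proof.
case: x y => [f hf] [g hg] /= /funext e; subst g.
by congr PadicInt; exact: Prop_irrelevance.
Qed.

Lemma residue_id x n : (x n %% q ^ n)%N = x n.
Proof. by rewrite -(residue_mod x n) modn_mod. Qed.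

Lemma residue_le x m n : (m <= n)%N -> (x n %% q ^ m)%N = x m.
Proof.
elim: n => [|n IH]; first by rewrite leqn0 => /eqP ->; rewrite residue_id.
rewrite leq_eqVlt => /orP[/eqP ->|]; first by rewrite residue_id.
rewrite ltnS => mn; rewrite -(IH mn) -(residue_mod x n).
by rewrite modn_dvdm // dvdn_exp2l.
Qed.

Let q_gt0 n : (0 < q ^ n)%N.
Proof. by rewrite expn_gt0 prime_gt0 // prime_base_prime. Qed.

Lemma mk_padic_mod (f : nat -> nat) :
  (forall n, f n.+1 = f n %[mod q ^ n])%N ->
  forall n, ((f n.+1 %% q ^ n.+1) %% q ^ n)%N = (f n %% q ^ n)%N.
Proof. by move=> h n; rewrite modn_dvdm ?h // dvdn_exp2l. Qed.

Definition mk_padic (f : nat -> nat)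
    (h : (forall n, f n.+1 = f n %[mod q ^ n])%N) : padic_int p :=
  PadicInt (mk_padic_mod h).

Lemma residue_eqm x n : (x n.+1 = x n %[mod q ^ n])%N.
Proof. by rewrite residue_id residue_mod. Qed.

Fact padic_cst_subproof k n : (k = k %[mod q ^ n])%N. Proof. by []. Qed.
Definition padic_of_nat (k : nat) : padic_int p := mk_padic (padic_cst_subproof k).

Fact padic_add_subproof x y n : (x n.+1 + y n.+1 = x n + y n %[mod q ^ n])%N.
Proof. by rewrite -modnDm !residue_eqm modnDm. Qed.
Definition padic_add x y : padic_int p := mk_padic (padic_add_subproof x y).

Fact padic_mul_subproof x y n : (x n.+1 * y n.+1 = x n * y n %[mod q ^ n])%N.
Proof. by rewrite -modnMm !residue_eqm modnMm. Qed.
Definition padic_mul x y : padic_int p := mk_padic (padic_mul_subproof x y).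

Fact padic_opp_subproof x n :
  (q ^ n.+1 * x n.+1 - x n.+1 = q ^ n * x n - x n %[mod q ^ n])%N.
Proof.
have le m k : (k <= q ^ m * k)%N by rewrite leq_pmull.
apply/eqP; rewrite -(eqn_modDr (x n.+1)) subnK //.
rewrite eq_sym -modnDmr residue_eqm modnDmr subnK //.
by rewrite expnSr -mulnA !modnMr.
Qed.
Definition padic_opp x : padic_int p := mk_padic (padic_opp_subproof x).

HB.instance Definition _ := gen_eqMixin (padic_int p).
HB.instance Definition _ := gen_choiceMixin (padic_int p).

Fact padic_addA : associative padic_add.
Proof. by move=> x y z; apply: padic_inj => n /=; rewrite modnDmr modnDml addnA. Qed.

Fact padic_addC : commutative padic_add.
Proof. by move=> x y; apply: padic_inj => n /=; rewrite addnC. Qed.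

Fact padic_add0 : left_id (padic_of_nat 0) padic_add.
Proof. by move=> x; apply: padic_inj => n /=; rewrite mod0n add0n residue_id. Qed.

Fact padic_addN : left_inverse (padic_of_nat 0) padic_opp padic_add.
Proof.
move=> x; apply: padic_inj => n /=.
by rewrite modnDml subnK ?leq_pmull // mod0n modnMr.
Qed.

HB.instance Definition _ :=
  GRing.isZmodule.Build (padic_int p) padic_addA padic_addC padic_add0 padic_addN.

Fact padic_mulA : associative padic_mul.
Proof. by move=> x y z; apply: padic_inj => n /=; rewrite modnMmr modnMml mulnA. Qed.

Fact padic_mulC : commutative padic_mul.
Proof. by move=> x y; apply: padic_inj => n /=; rewrite mulnC. Qed.

Fact padic_mul1 : left_id (padic_of_nat 1) padic_mul.
Proof. by move=> x; apply: padic_inj => n /=; rewrite modnMml mul1n residue_id. Qed.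

Fact padic_mulD : left_distributive padic_mul padic_add.
Proof.
by move=> x y z; apply: padic_inj => n /=; rewrite modnMml modnDm mulnDl.
Qed.

Fact padic_1neq0 : padic_of_nat 1 != 0 :> padic_int p.
Proof.
apply/eqP => /(congr1 (fun x : padic_int p => x 1)) /=.
by rewrite mod0n expn1 modn_small // prime_gt1 // prime_base_prime.
Qed.

HB.instance Definition _ := GRing.Zmodule_isComNzRing.Build (padic_int p)
  padic_mulA padic_mulC padic_mul1 padic_mulD padic_1neq0.

Definition padic_unit : pred (padic_int p) := fun x => `[< exists y, y * x = 1 >].
Definition padic_inv x : padic_int p :=
  if pselect (exists y, y * x = 1) is left e then sval (cid e) else x.

Fact padic_mulV : {in padic_unit, left_inverse 1 padic_inv *%R}.
Proof.
move=> x /asboolP h; rewrite /padic_inv; case: pselect => // e.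
exact: (svalP (cid e)).
Qed.

Fact padic_unitP x y : y * x = 1 -> padic_unit x.
Proof. by move=> h; apply/asboolP; exists y. Qed.

Fact padic_inv_out : {in [predC padic_unit], padic_inv =1 id}.
Proof.
move=> x /asboolP h; rewrite /padic_inv; case: pselect => // e.
Qed.

HB.instance Definition _ := GRing.ComNzRing_hasMulInverse.Build (padic_int p)
  padic_mulV padic_unitP padic_inv_out.

Fact padic_neq0P x : x != 0 -> exists n, x n != 0%N.
Proof.
move=> /eqP x0; apply: contrapT => h; apply: x0; apply: padic_inj => n /=.
by rewrite mod0n; apply/eqP; apply: contrapT => /negP xn; apply: h; exists n.
Qed.

Fact padic_integral x y : x * y = 0 -> (x == 0) || (y == 0).
Proof.
move=> xy0; apply/negPn; rewrite negb_or; apply/negP.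
move=> /andP[/padic_neq0P[m xm] /padic_neq0P[n yn]].
have nd z k l : (k <= l)%N -> z k != 0%N ->
    (0 < z l)%N /\ (logn q (z l) < k)%N.
  move=> kl zk; have nd : ~~ (q ^ k %| z l)%N by rewrite /dvdn residue_le.
  have z0 : (0 < z l)%N.
    by rewrite lt0n; apply: contra nd => /eqP ->; rewrite dvdn0.
  by split=> //; move: nd; rewrite pfactor_dvdn ?prime_base_prime // -ltnNge.
have [x0 lx] := nd x m (m + n)%N (leq_addr _ _) xm.
have [y0 ly] := nd y n (m + n)%N (leq_addl _ _) yn.
move: xy0 => /(congr1 (fun z : padic_int p => z (m + n)%N)) /=.
rewrite mod0n => /eqP; rewrite -[_ == _]/(_ %| _)%N.
rewrite pfactor_dvdn ?prime_base_prime ?muln_gt0 ?x0 // lognM //.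
by rewrite leqNgt -addnS leq_add // ltnW.
Qed.

HB.instance Definition _ := GRing.ComUnitRing_isIntegral.Build (padic_int p) padic_integral.

End PadicRing.

Definition padic_num (p : nat) : fieldType := {fraction padic_int p}.

(* The p-adic valuation of x is the largest n with x = 0 mod p^n; the junk
   value 0 is used at x = 0. *)
Definition padic_val (p : nat) (x : padic_int p) : nat :=
  if pselect (exists n, x n != 0%N) is left e then (ex_minn e).-1 else 0%N.

(* y^2 + a1 x y + a3 y = x^3 + a2 x^2 + a4 x + a6 *)
Record weierstrass (K : Type) : Type := Weierstrass {
  wa1 : K; wa2 : K; wa3 : K; wa4 : K; wa6 : K }.

Definition map_weierstrass (K K' : Type) (f : K -> K') (W : weierstrass K) :
    weierstrass K' :=
  Weierstrass (f (wa1 W)) (f (wa2 W)) (f (wa3 W)) (f (wa4 W)) (f (wa6 W)).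

Section Weierstrass.
Variable K : comNzRingType.
Implicit Type W : weierstrass K.

Definition wb2 W : K := wa1 W ^+ 2 + wa2 W *+ 4.
Definition wb4 W : K := wa4 W *+ 2 + wa1 W * wa3 W.
Definition wb6 W : K := wa3 W ^+ 2 + wa6 W *+ 4.
Definition wb8 W : K :=
  wa1 W ^+ 2 * wa6 W + wa2 W * wa6 W *+ 4 - wa1 W * wa3 W * wa4 W
  + wa2 W * wa3 W ^+ 2 - wa4 W ^+ 2.

Definition wdisc W : K :=
  - wb2 W ^+ 2 * wb8 W - wb4 W ^+ 3 *+ 8 - wb6 W ^+ 2 *+ 27
  + wb2 W * wb4 W * wb6 W *+ 9.

Definition is_elliptic W : bool := wdisc W != 0.

Definition on_curve W (x y : K) : bool :=
  y ^+ 2 + wa1 W * x * y + wa3 W * y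
    == x ^+ 3 + wa2 W * x ^+ 2 + wa4 W * x + wa6 W.

Definition singular_point W (x y : K) : bool :=
  [&& on_curve W x y,
      wa1 W * y == x ^+ 2 *+ 3 + wa2 W * x *+ 2 + wa4 W
    & y *+ 2 + wa1 W * x + wa3 W == 0].

(* At a singular point (x, y) the tangent cone, in the coordinates
   X - x, Y - y, is Y^2 + a1 X Y - (3 x + a2) X^2; this polynomial in the
   slope T = Y / X has the slopes of the tangent lines as its roots. *)
Definition tangent_slope W (x m : K) : bool :=
  m ^+ 2 + wa1 W * m - (x *+ 3 + wa2 W) == 0.

(* A node is a singular point with two distinct tangents, possibly defined
   over a quadratic extension only; the other singular points are cusps. *)
Definition is_node W (x y : K) : bool :=
  singular_point W x y && (wa1 W ^+ 2 + (x *+ 3 + wa2 W) *+ 4 != 0).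

End Weierstrass.

(* The change of variables X = u^2 X' + r, Y = u^3 Y' + s u^2 X' + t turns W
   into W'. *)
Definition weierstrass_iso (K : fieldType) (W W' : weierstrass K) : Prop :=
  exists u r s t : K,
    u != 0 /\
    [/\ u * wa1 W' = wa1 W + s *+ 2,
        u ^+ 2 * wa2 W' = wa2 W - s * wa1 W + r *+ 3 - s ^+ 2,
        u ^+ 3 * wa3 W' = wa3 W + r * wa1 W + t *+ 2,
        u ^+ 4 * wa4 W' = wa4 W - s * wa3 W + r * wa2 W *+ 2
          - (t + r * s) * wa1 W + r ^+ 2 *+ 3 - s * t *+ 2
      & u ^+ 6 * wa6 W' = wa6 W + r * wa4 W + r ^+ 2 * wa2 W + r ^+ 3
          - t * wa3 W - t ^+ 2 - r * t * wa1 W].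

Definition integral_model (p : nat) (E : weierstrass rat)
    (W : weierstrass (padic_int p)) : Prop :=
  weierstrass_iso (map_weierstrass (ratr : rat -> padic_num p) E)
    (map_weierstrass (fun x => FracField.tofrac x : padic_num p) W).

Definition minimal_model (p : nat) (E : weierstrass rat)
    (W : weierstrass (padic_int p)) : Prop :=
  integral_model E W /\
  forall W' : weierstrass (padic_int p), integral_model E W' ->
    (padic_val (wdisc W) <= padic_val (wdisc W'))%N.

(* Only meaningful when F has characteristic p: the residue mod p of each
   coefficient is sent to F. *)
Definition reduction (F : nzRingType) (p : nat) (W : weierstrass (padic_int p)) :
    weierstrass F :=
  map_weierstrass (fun x : padic_int p => (x 1%N)%:R) W.

(* Affine points, singular or not, and the point at infinity. *)
Definition npoints (F : finFieldType) (W : weierstrass F) : nat :=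
  #|[set P : F * F | on_curve W P.1 P.2]%SET|.+1.

Section Reduction.
Variables (p : nat) (W : weierstrass (padic_int p)).
Let Wp : weierstrass 'F_p := reduction 'F_p W.

Definition good_reduction : bool := is_elliptic Wp.

Definition multiplicative_reduction : bool :=
  [exists P : 'F_p * 'F_p, is_node Wp P.1 P.2].

Definition split_reduction : bool :=
  [exists P : 'F_p * 'F_p,
    is_node Wp P.1 P.2 && [exists m, tangent_slope Wp P.1 m]].

End Reduction.

Section Counting.
Variable W : forall p : nat, weierstrass (padic_int p).

(* t is the function t(n); its value at 0 is irrelevant. *)
Definition is_trace_function (t : nat -> int) : Prop :=
  [/\ t 1%N = 1,
      forall m n, (0 < m)%N -> (0 < n)%N -> coprime m n ->
        t (m * n)%N = t m * t n
    & forall (p l : nat) (F : finFieldType), prime p -> (0 < l)%N ->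
        #|F| = (p ^ l)%N ->
        (npoints (reduction F (W p)))%:Z = (p ^ l)%N%:Z + 1 - t (p ^ l)%N].

Definition bad_primes : set nat :=
  [set p | prime p /\ ~~ good_reduction (W p)].

End Counting.

Definition pointN (t : nat -> int) (n : nat) : int := n%:Z + 1 - t n.

(* The topology of R[i] is the one of its norm, as for every numFieldType. *)
HB.instance Definition _ (R : realType) :=
  NormedModule.copy R[i] (R[i] : numFieldType).

Section Complex.
Variable R : realType.
Local Notation C := R[i].

Definition cexp (z : C) : C :=
  Complex (expR (complex.Re z) * cos (complex.Im z))
          (expR (complex.Re z) * sin (complex.Im z)).

(* n ^ z for a positive integer n *)
Definition npow (n : nat) (z : C) : C := cexp (z * (ln n%:R)%:C%C).

Definition dirichlet (a : nat -> C) (s : C) : C :=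
  limn (fun M : nat => \sum_(1 <= n < M) a n * npow n (- s)).

Definition zeta_series : C -> C := dirichlet (fun=> 1).

Definition analytic_at (g : C -> C) (a : C) : Prop :=
  exists c : nat -> C, \forall z \near a,
    (fun M : nat => \sum_(0 <= n < M) c n * (z - a) ^+ n) @ \oo --> g z.

(* g is the analytic continuation to the domain V of the function given by f
   on some right half-plane. *)
Definition analytic_continuation (f : C -> C) (V : set C) (g : C -> C) : Prop :=
  [/\ open V, connected V, (forall a, V a -> analytic_at g a)
    & exists sigma : R, forall s, sigma < complex.Re s -> V s /\ g s = f s].

Variable W : forall p : nat, weierstrass (padic_int p).

(* alpha p is determined up to complex conjugation; its values at the other
   indices are irrelevant. *)
Definition frobenius_eigenvalues (t : nat -> int) (alpha : nat -> C) : Prop :=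
  forall p, prime p -> good_reduction (W p) ->
    `|alpha p| = (Num.sqrt p%:R)%:C%C /\
    forall l, (0 < l)%N ->
      (pointN t (p ^ l))%:~R =
        (p ^ l)%N%:R + 1 - alpha p ^+ l - (conjc (alpha p)) ^+ l :> C.

(* The last case is additive reduction: the singular point is a cusp. *)
Definition local_factor (alpha : nat -> C) (p : nat) (s : C) : C :=
  if good_reduction (W p) then
    ((1 - alpha p * npow p (- s)) * (1 - conjc (alpha p) * npow p (- s)))^-1
  else if split_reduction (W p) then (1 - npow p (- s))^-1
  else if multiplicative_reduction (W p) then (1 + npow p (- s))^-1
  else 1.

Definition L_product (alpha : nat -> C) (s : C) : C :=
  limn (fun M : nat => \prod_(0 <= p < M | prime p) local_factor alpha p s).

Definition bad_factor (s : C) : C :=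
  \big[*%R/1]_(p \in bad_primes W) (1 - npow p (1 - 2%:R * s)).

(* Only the logarithmic derivative is prescribed, hence a predicate: Z is
   determined up to a multiplicative constant. *)
Definition is_modified_zeta (t : nat -> int) (sigma : R) (Z : C -> C) : Prop :=
  forall s, sigma < complex.Re s ->
    [/\ derivable Z s 1, Z s != 0
      & derive1 Z s / Z s = - dirichlet (fun n => (pointN t n)%:~R) (s + 1)].

End Complex.

(* Main.v *)
Require Import Defs.
From HB Require Import structures.
From mathcomp Require Import all_boot all_order all_algebra all_field complex.
From mathcomp Require Import all_classical all_reals all_analysis.
From mathcomp Require Import ring lra zify.

Set Implicit Arguments.
Unset Strict Implicit.
Unset Printing Implicit Defensive.

Import Order.TTheory GRing.Theory Num.Theory.
Import numFieldNormedType.Exports.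

Local Open Scope classical_set_scope.
Local Open Scope ring_scope.

(** Write w = s + 1 and let T(w) be the Dirichlet series of t. Since
N(n) n^-w is n^-s + n^-w - t(n) n^-w, the logarithmic derivative of the
modified zeta function is - zeta(s) - zeta(s + 1) + T(s + 1), and everything
comes down to T(w) = L(w) / (zeta(2w - 1) M(w)), where 2w - 1 = 2s + 1.

Both sides are Euler products, so this is checked at one prime p at a time
([trace_local_cvg]). With x = p^-w:
- if the reduction is good, t(p^l) = a^l + b^l for l > 0, with b the conjugate
  of a, and a b = p; the two geometric series add up to
  (1 - a b x^2) / ((1 - a x) (1 - b x)) = (1 - p^(1 - 2w)) L_p(w);
- if it is bad, t(p^l) is 1, (-1)^l or 0 for l > 0, and the factor of T is
  L_p(w) itself.
The factors 1 - p^(1 - 2w) over all primes form 1 / zeta(2w - 1); M(w) gives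
back those that belong to the bad primes.

The values of t at a bad prime ([trace_bad]) come from counting the points of
a singular cubic over a finite field. Such a cubic has a rational singular
point, because finite fields are perfect ([disc0_singular]). The lines through
that point meet the cubic in exactly one further point, except the tangents
([npoints_singular]), so that t(q) + 1 is the number of tangents with slope in
the field with q elements: 2 in the split case, 2 or 0 according to the parity
of l in the non-split case, 1 for a cusp.

Convergence needs only abs t(n) <= n ([trace_le]): a line x = const meets the
affine curve in at most two points. The product M is finite because an
integral scaling of the equation of E is a p-integral
equation for every p, so minimality forces good reduction at each prime that
does not divide its discriminant ([bad_primes_finite]).

For the continued functions, multiply the difference of the two sides by
zeta(2s + 1) M(s + 1). The result is analytic on U and vanishes on a half
plane, hence on the connected set U ([identity_theorem]). Analyticity means
having power series expansions; the Cauchy product ([cvg_convolution]) shows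
that products of analytic functions are analytic, and zeros of an analytic
function that is not locally zero are isolated ([isolated_zeros]). *)

(** * Singular points of cubics of discriminant zero *)

Lemma finField_root (F : finFieldType) (p : nat) (z : F) :
  p \in [pchar F] -> exists y, y ^+ p = z.
Proof.
move=> pF; have : injective (pFrobenius_aut pF) by exact: fmorph_inj.
by move=> /injF_bij[g _ gK]; exists (g z); exact: (gK z).
Qed.

Section SingularPoint.
Variables (F : fieldType) (W : weierstrass F).
Local Notation b2 := (wb2 W).
Local Notation b4 := (wb4 W).
Local Notation b6 := (wb6 W).

(** Away from characteristic 2, completing the square in y turns the equation
into v^2 = f(x) with f the cubic below, and a double root of f is the abscissa
of a singular point. The second hypothesis is f'(x) = 0 divided by 2. *)
Lemma singular_cubic (x : F) : 2%:R != 0 :> F ->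
  4 * x ^+ 3 + b2 * x ^+ 2 + 2 * b4 * x + b6 = 0 -> 6 * x ^+ 2 + b2 * x + b4 = 0 ->
  exists y, singular_point W x y.
Proof.
move=> n2 f0 f1; exists (- (wa1 W * x + wa3 W) / 2).
move: f0 f1; rewrite /wb2 /wb4 /wb6 => f0 f1.
have n4 : 4%:R != 0 :> F by rewrite (natrM _ 2 2) mulf_neq0.
rewrite /singular_point /on_curve.
apply/and3P; split; [rewrite -subr_eq0|rewrite -subr_eq0|]; apply/eqP.
- apply: (mulfI n4); rewrite mulr0 -[RHS](oppr0) -f0; field.
  exact: n2.
- apply: (mulfI n2); rewrite mulr0 -[RHS](oppr0) -f1; field.
  exact: n2.
- by field.
Qed.

(** This is the discriminant in the form to which b8 does not contribute,
using 4 b8 = b2 b6 - b4^2. *)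
Lemma four_disc : 4 * wdisc W =
  - b2 ^+ 2 * (b2 * b6 - b4 ^+ 2) - 32 * b4 ^+ 3 - 108 * b6 ^+ 2 + 36 * b2 * b4 * b6.
Proof. by rewrite /wdisc /wb8 /wb2 /wb4 /wb6; ring. Qed.

(** A cubic whose discriminant vanishes has a double root, given by a rational
expression in its coefficients when c4 = b2^2 - 24 b4 is not zero. When c4 = 0
the root is triple, which in characteristic 3 requires a cube root. *)
Lemma singular_char_neq2 : 2%:R != 0 :> F ->
  3%:R != 0 :> F \/ (forall z : F, exists y, y ^+ 3 = z) ->
  wdisc W = 0 -> exists x y, singular_point W x y.
Proof.
move=> n2 h3 d0; have := four_disc; rewrite d0 mulr0.
move: (singular_cubic^~ n2); move: b2 b4 b6 => u v w.
have n4 : 4%:R != 0 :> F by rewrite (natrM _ 2 2) mulf_neq0.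
move=> H D; case: (eqVneq (u ^+ 2 - 24 * v) 0) => [c4|c4]; last first.
  (* Euclid's algorithm on f and f' leaves a linear remainder, with root x. *)
  pose c := u ^+ 2 - 24 * v; pose x := (18 * w - u * v) / c.
  have cx : c * x = 18 * w - u * v by rewrite /x mulrC divfK.
  exists x; apply: H.
  - apply: (mulfI (expf_neq0 3 c4)); rewrite mulr0 -/c.
    transitivity (4 * (c * x) ^+ 3 + u * (c * x) ^+ 2 * c
                  + 2 * v * (c * x) * c ^+ 2 + w * c ^+ 3); first by ring.
    rewrite cx -(mul0r (- (u ^+ 3) + 36 * u * v - 216 * w)) D /c; ring.
  - apply: (mulfI (expf_neq0 2 c4)); rewrite mulr0 -/c.
    transitivity (6 * (c * x) ^+ 2 + u * (c * x) * c + v * c ^+ 2); first by ring.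
    rewrite cx -(mul0r (- 18)) D /c; ring.
case: (eqVneq (3%:R : F) 0) h3 => [e3|n3] h3.
  case: h3 => [//|h3].
  have z3 (z : F) : 3 * z = 0 by rewrite e3 mul0r.
  have u0 : u = 0.
    apply/eqP; rewrite -sqrf_eq0; apply/eqP.
    by rewrite -c4 -[LHS]subr0 -(z3 (8 * v)); ring.
  have v0 : v = 0.
    apply/eqP; have := esym D; rewrite u0.
    rewrite (_ : _ + _ = - (32 * v ^+ 3) + 3 * (- 36 * w ^+ 2)); last by ring.
    rewrite z3 addr0 => /eqP; rewrite oppr_eq0 mulf_eq0 expf_eq0 /= => /orP[|//].
    by rewrite (natrM _ 4 8) (natrM _ 4 2) !mulf_eq0 (negbTE n4) (negbTE n2).
  have [x xE] := h3 (- w); exists x; apply: H; rewrite ?u0 ?v0 ?xE.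
    by rewrite -[RHS](z3 (- w)); ring.
  by rewrite -[RHS](z3 (2 * x ^+ 2)); ring.
have n12 : 12%:R != 0 :> F by rewrite (natrM _ 3 4) mulf_neq0.
(* The triple root is - b2 / 12, and f = 4 (x + k)^3. *)
pose k := u / 12; have uE : u = 12 * k by rewrite /k mulrC divfK.
have n24 : 24%:R != 0 :> F by rewrite (natrM _ 2 12) mulf_neq0.
have vE : v = 6 * k ^+ 2.
  by apply: (mulfI n24); rewrite -[LHS]addr0 -c4 uE; ring.
have n108 : 108%:R != 0 :> F by rewrite (natrM _ 3 36) (natrM _ 3 12) !mulf_neq0.
have wE : w = 4 * k ^+ 3.
  apply/eqP; rewrite -subr_eq0 -sqrf_eq0; apply/eqP.
  by apply: (mulfI n108); rewrite mulr0 -[RHS]oppr0 D vE uE; ring.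
by exists (- k); apply: H; rewrite vE ?wE uE; ring.
Qed.

(** In characteristic 2 the vanishing of the derivative in y reads
a1 x = a3, which determines x unless a1 = 0; then disc = a3^4, so a3 = 0 as
well and the derivative in x becomes x^2 = a4. *)
Lemma singular_char2 : 2%:R = 0 :> F -> (forall z : F, exists y, y ^+ 2 = z) ->
  wdisc W = 0 -> exists x y, singular_point W x y.
Proof.
move=> e2 h2; have z2 (z : F) : 2 * z = 0 by rewrite e2 mul0r.
rewrite /singular_point /on_curve /wdisc /wb8 /wb2 /wb4 /wb6.
move: (wa1 W) (wa2 W) (wa3 W) (wa4 W) (wa6 W) => a1 a2 a3 a4 a6 D.
have zN (z : F) : - z = z by apply/eqP; rewrite eq_sym -addr_eq0 -mulr2n -mulr_natl z2.
have z4 (z : F) : z *+ 4 = 0 by rewrite -[RHS](z2 (2 * z)); ring.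
have z8 (z : F) : z *+ 8 = 0 by rewrite -[RHS](z2 (4 * z)); ring.
have z22 (z : F) : z *+ 2 = 0 by rewrite -[RHS](z2 z); ring.
have z9 (z : F) : z *+ 9 = z by rewrite -[RHS]addr0 -(z2 (4 * z)); ring.
have z27 (z : F) : z *+ 27 = z by rewrite -[RHS]addr0 -(z2 (13 * z)); ring.
move: D; rewrite !(z4, z8, z9, z27, z22, zN, addr0, add0r) => D.
case: (eqVneq a1 0) D => [->|n1] D.
  have a30 : a3 = 0.
    have : a3 ^+ 4 == 0 by apply/eqP; rewrite -D; ring.
    by rewrite expf_eq0 /= => /eqP.
  have [x xE] := h2 a4; have [y yE] := h2 (x ^+ 3 + a2 * x ^+ 2 + a4 * x + a6).
  exists x, y; apply/and3P; rewrite a30; split; [rewrite -subr_eq0| rewrite -subr_eq0|]; apply/eqP.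
  - by rewrite -yE; ring.
  - by rewrite -xE -[RHS]oppr0 -[in RHS](z2 (2 * x ^+ 2 + a2 * x)); ring.
  - by rewrite -[RHS](z2 y); ring.
pose x := a3 / a1; pose y := (x ^+ 2 + a4) / a1.
have a3E : a3 = a1 * x by rewrite /x mulrC divfK.
have a4E : a4 = a1 * y - x ^+ 2 by rewrite /y mulrC divfK // addrC addKr.
exists x, y; clearbody x y; apply/and3P; split; [rewrite -subr_eq0| rewrite -subr_eq0|]; apply/eqP.
- apply: (mulfI (expf_neq0 6 n1)); rewrite mulr0 -[RHS]subr0 -{1}D.
  rewrite -(z2 (a1 ^+ 6 * a2 * x ^+ 2 + a1 ^+ 6 * a6 - a1 ^+ 5 * y * x ^+ 2 + a1 ^+ 4 * x ^+ 4)).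
  by rewrite a3E a4E; ring.
- by rewrite a4E -[RHS]oppr0 -[in RHS](z2 (x ^+ 2 + a2 * x)); ring.
- by rewrite a3E -[RHS](z2 (y + a1 * x)); ring.
Qed.

End SingularPoint.

(** Only square roots in characteristic 2 and cube roots in characteristic 3
have to be extracted, and a finite field of characteristic p is closed under
p-th roots. *)
Lemma disc0_singular (F : finFieldType) (W : weierstrass F) :
  wdisc W = 0 -> exists x y, singular_point W x y.
Proof.
move=> d0; case: (eqVneq (2%:R : F) 0) => [e2|n2].
  by apply: singular_char2 => // z; apply: finField_root; rewrite inE /= e2.
apply: singular_char_neq2 => //.
case: (eqVneq (3%:R : F) 0) => [e3|n3]; [right=> z|by left].
by apply: finField_root; rewrite inE /= e3.
Qed.

(** * Counting points on a singular cubic *)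

(** The line of slope m through the singular point (x0, y0) meets the cubic
there twice, and once more at the point with x - x0 = h m, where h is the
tangent polynomial. This third point is a new one exactly when m is not a
tangent slope; the vertical line contributes the point at infinity. *)
Lemma npoints_singular (F : finFieldType) (W : weierstrass F) (x0 y0 : F) :
  singular_point W x0 y0 ->
  (npoints W + #|[set m | tangent_slope W x0 m]%SET| = #|F|.+2)%N.
Proof.
rewrite /singular_point /npoints /on_curve /tangent_slope.
move: (wa1 W) (wa2 W) (wa3 W) (wa4 W) (wa6 W) => a1 a2 a3 a4 a6 /and3P[/eqP H0 /eqP Hx /eqP Hy].
pose S := [set P : F * F | P.2 ^+ 2 + a1 * P.1 * P.2 + a3 * P.2 ==
           P.1 ^+ 3 + a2 * P.1 ^+ 2 + a4 * P.1 + a6]%SET.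
pose T := [set m | m ^+ 2 + a1 * m - (x0 *+ 3 + a2) == 0]%SET.
change (#|S|.+1 + #|T| = #|F|.+2)%N.
pose h m := m ^+ 2 + a1 * m - (x0 *+ 3 + a2).
pose g m : F * F := (x0 + h m, y0 + m * h m).
have curveE u v : (y0 + v) ^+ 2 + a1 * (x0 + u) * (y0 + v) + a3 * (y0 + v) -
  ((x0 + u) ^+ 3 + a2 * (x0 + u) ^+ 2 + a4 * (x0 + u) + a6) =
  v ^+ 2 + a1 * u * v - (x0 *+ 3 + a2) * u ^+ 2 - u ^+ 3.
  have e1 : y0 ^+ 2 + a1 * x0 * y0 + a3 * y0 - (x0 ^+ 3 + a2 * x0 ^+ 2 + a4 * x0 + a6) = 0.
    by rewrite H0 subrr.
  have e2 : (a1 * y0 - (x0 ^+ 2 *+ 3 + a2 * x0 *+ 2 + a4)) * u = 0 by rewrite Hx subrr mul0r.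
  have e3 : (y0 *+ 2 + a1 * x0 + a3) * v = 0 by rewrite Hy mul0r.
  by rewrite -[RHS]addr0 -[in RHS]e1 -[RHS]addr0 -[in RHS]e2 -[RHS]addr0 -[in RHS]e3; ring.
have onE u v : (v ^+ 2 + a1 * u * v - (x0 *+ 3 + a2) * u ^+ 2 - u ^+ 3 == 0) =
    (u == 0) && (v == 0) || (u != 0) && (h (v / u) == u).
  case: (eqVneq u 0) => [->|u0] /=.
    by rewrite mulr0 mul0r !expr0n /= mulr0 !subr0 addr0 sqrf_eq0 orbF.
  rewrite -[in RHS]subr_eq0 -[RHS](inj_eq (mulfI (expf_neq0 2 u0))) mulr0.
  by congr (_ == 0); rewrite /h; field.
have SE : S = ((x0, y0) |: [set g m | m in [set m | h m != 0]])%SET :> {set F * F}.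
  apply/setP => -[x y]; rewrite !inE /=.
  have [u xE] : exists u, x = x0 + u by exists (x - x0); rewrite addrC subrK.
  have [v yE] : exists v, y = y0 + v by exists (y - y0); rewrite addrC subrK.
  rewrite {}xE {}yE -subr_eq0 curveE onE; congr (_ || _).
    have sh (a b : F) : (a + b == a) = (b == 0).
      by rewrite -[X in _ == X]addr0 (inj_eq (addrI a)).
    by rewrite xpair_eqE !sh.
  apply/andP/imsetP => [[u0 /eqP e]|[m]].
    by exists (v / u); rewrite ?inE /g e // divfK.
  rewrite inE => hm [/addrI -> /addrI ->]; split=> //.
  by rewrite mulfK.
have gi : {in [set m | h m != 0]%SET &, injective g}.
  move=> m n; rewrite !inE => hm hn [/addrI e /addrI].
  by rewrite -e => /(mulIf hm).
rewrite SE cardsU1 card_in_imset //.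
have -> : (x0, y0) \notin [set g m | m in [set m | h m != 0]]%SET.
  apply/imsetP => -[m]; rewrite inE => hm [/eqP].
  by rewrite -{1}(addr0 x0) => /eqP/addrI e; rewrite -e eqxx in hm.
have -> : [set m | h m != 0]%SET = (~: [set m | h m == 0])%SET.
  by apply/setP => m; rewrite !inE.
by rewrite -(cardsC T) -/T add1n !addSn addnC.
Qed.

(** The roots are m and - b - m; they coincide when 2 m + b = 0, and
(2 m + b)^2 = b^2 + 4 c. *)
Lemma card_quad_roots (F : finFieldType) (b c m : F) :
  m ^+ 2 + b * m - c == 0 ->
  #|[set x | x ^+ 2 + b * x - c == 0]%SET| = (b ^+ 2 + c *+ 4 != 0).+1.
Proof.
move=> /eqP mE; have cE : c = m ^+ 2 + b * m by apply/eqP; rewrite eq_sym -subr_eq0 mE.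
have -> : [set x | x ^+ 2 + b * x - c == 0]%SET = [set m; - b - m]%SET.
  apply/setP => x; rewrite !inE -[x == m]subr_eq0 -(subr_eq0 x) -mulf_eq0.
  by congr (_ == 0); rewrite cE; ring.
rewrite cards2; congr (nat_of_bool _).+1; congr (~~ _).
have -> : b ^+ 2 + c *+ 4 = (m *+ 2 + b) ^+ 2 by rewrite cE; ring.
rewrite sqrf_eq0 -subr_eq0; congr (_ == 0); ring.
Qed.

Lemma quad_cusp_root (F : finFieldType) (b c : F) : b ^+ 2 + c *+ 4 = 0 ->
  exists m, m ^+ 2 + b * m - c == 0.
Proof.
move=> d0; case: (eqVneq (2%:R : F) 0) => [e2|n2].
  have [m mE] : exists m, m ^+ 2 = c by apply: finField_root; rewrite inE /= e2.
  exists m; rewrite mE.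
  have c4 : c *+ 4 = 0 by rewrite -(mul0r (2 * c)) -e2; ring.
  move: d0; rewrite c4 addr0 => /eqP; rewrite sqrf_eq0 => /eqP ->.
  by rewrite mul0r addr0 subrr.
have n4 : 4%:R != 0 :> F by rewrite (natrM _ 2 2) mulf_neq0.
exists (- b / 2); apply/eqP; apply: (mulfI n4); rewrite mulr0 -[RHS]oppr0 -d0; field.
exact: n2.
Qed.

(** The p-th power map permutes the roots x of the quadratic, which has its
coefficients in the prime field, and cannot fix x because x is not in the
prime field; so x^p is the other root and x^(p^2) = x. Hence x lies in the
field with p^l elements, where x^(p^l) = x, only if l is even. Conversely, for
even l the same argument with the class of 'X modulo the quadratic g shows
that g divides 'X^(p^l) - 'X, which splits. *)
Lemma quad_nonsplit (p l : nat) (F : finFieldType) (f : {rmorphism 'F_p -> F}) (b c : 'F_p) :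
  prime p -> #|F| = (p ^ l)%N -> b ^+ 2 + c *+ 4 != 0 ->
  (forall m : 'F_p, m ^+ 2 + b * m - c != 0) ->
  #|[set x | x ^+ 2 + f b * x - f c == 0]%SET| = if odd l then 0%N else 2.
Proof.
move=> pp cF dn0 nr.
have pF : p \in [pchar F] by rewrite (fmorph_pchar f) pchar_Fp.
have frob (a : 'F_p) : f a ^+ p = f a.
  by rewrite -rmorphXn -[X in a ^+ X](card_Fp pp) expf_card.
have frobD (x y : F) : (x + y) ^+ p = x ^+ p + y ^+ p.
  exact: (rmorphD (pFrobenius_aut pF)).
have frobN (x : F) : (- x) ^+ p = - x ^+ p.
  exact: (rmorphN (pFrobenius_aut pF)).
have rootF x : x ^+ 2 + f b * x - f c == 0 -> x ^+ p = - f b - x.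
  move=> /eqP xr.
  have xpr : (x ^+ p) ^+ 2 + f b * x ^+ p - f c = 0.
    rewrite -[in f b * _]frob -exprMn -[in - f c](frob c) -frobN -exprAC -!frobD xr.
    by rewrite expr0n; case: (p) pp.
  have /eqP : (x ^+ p - x) * (x ^+ p - (- f b - x)) = 0.
    rewrite -[RHS](subrr 0) -{1}xpr -xr; ring.
  rewrite mulf_eq0 subr_eq0 [in X in _ || X]subr_eq0 => /orP[|/eqP //] /eqP xp.
  (* A fixed point of the p-th power map is in the prime field. *)
  have : \prod_(a : 'F_p) (x - f a) = 0.
    have := finField_genPoly 'F_p; rewrite card_Fp // => /(congr1 (map_poly f)).
    rewrite rmorphB rmorph_prod /= map_polyXn map_polyX => /(congr1 (horner^~ x)).
    rewrite /= !hornerE xp subrr horner_prod => ->.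
    by apply: eq_bigr => a _; rewrite rmorphB /= map_polyX map_polyC !hornerE.
  move=> /eqP/prodf_eq0[a _]; rewrite subr_eq0 => /eqP xa.
  move: (nr a) xr; rewrite xa -rmorphXn -rmorphM -rmorphD -rmorphB /=.
  by move=> /negP h /eqP; rewrite fmorph_eq0.
have dF : f b ^+ 2 + f c *+ 4 != 0.
  by rewrite -rmorphXn -rmorphMn -rmorphD fmorph_eq0.
have frob2 x : x ^+ 2 + f b * x - f c == 0 -> x ^+ p ^+ p = x.
  by move=> hx; rewrite (rootF x hx) frobD !frobN frob (rootF x hx); ring.
have noroot : (forall x, x ^+ 2 + f b * x - f c != 0) \/
   exists x, x ^+ 2 + f b * x - f c == 0.
  case: (pselect (exists x, x ^+ 2 + f b * x - f c == 0)) => [h|h]; first by right.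
  by left=> x; apply/negP => hx; apply: h; exists x.
have frobi x k : x ^+ 2 + f b * x - f c == 0 ->
    x ^+ (p ^ k) = if odd k then - f b - x else x.
  move=> hx; elim: k => [|k IH]; first by rewrite expr1.
  rewrite expnSr exprM IH /=; case: (odd k) => /=; last exact: rootF.
  by rewrite -(rootF x hx) frob2.
case: noroot => [noroot|[x hx]]; last first.
  rewrite (card_quad_roots hx) dF; case: ifP => // ol.
  have := frobi x l hx; rewrite ol -cF expf_card => xE.
  have cE : f c = x ^+ 2 + f b * x by apply/eqP; rewrite eq_sym -subr_eq0.
  have bE : f b = - x - x by rewrite {1}xE; ring.
  by move: dF; rewrite cE bE => /eqP[]; ring.
rewrite (_ : [set x | _]%SET = finset.set0) ?cards0; last first.
  by apply/setP => x; rewrite !inE (negbTE (noroot x)).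
case: ifP => // ol; exfalso.
pose g : {poly F} := 'X^2 + (f b)%:P * 'X - (f c)%:P.
have rg x : root g x = false by rewrite /root /g !hornerE (negbTE (noroot x)).
have sg : size g = 3.
  rewrite /g -addrA size_polyDl ?size_polyXn //.
  by rewrite -polyCN size_MXaddC; case: ifP => // _; rewrite size_polyC; case: eqP.
have gi : irreducible_poly g by apply: cubic_irreducible => [|x]; rewrite ?sg ?rg.
have pP : p \in [pchar {poly F}] by rewrite pchar_poly.
have PD (u v : {poly F}) : (u + v) ^+ p = u ^+ p + v ^+ p.
  exact: (rmorphD (pFrobenius_aut pP)).
have PN (u : {poly F}) : (- u) ^+ p = - u ^+ p.
  exact: (rmorphN (pFrobenius_aut pP)).
have gp : g ^+ p - g = ('X^p - 'X) * ('X^p + 'X + (f b)%:P).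
  have -> : g ^+ p = 'X^p ^+ 2 + (f b)%:P * 'X^p - (f c)%:P.
    by rewrite /g !PD PN exprAC exprMn -!polyC_exp !frob.
  by rewrite /g; ring.
have gX2 : g %| 'X^p ^+ p - 'X.
  have : g %| g ^+ p - g by rewrite dvdp_sub ?dvdpp // dvdp_exp ?prime_gt0.
  have gdp u : g %| u -> g %| u ^+ p by move=> gu; rewrite dvdp_exp ?prime_gt0.
  rewrite gp; case/boolP: (g %| 'X^p - 'X) => [h _|h].
    rewrite (_ : _ - _ = ('X^p - 'X) ^+ p + ('X^p - 'X)); last by rewrite PD PN; ring.
    by rewrite dvdp_add ?gdp.
  rewrite Gauss_dvdpr ?irreducible_poly_coprime // => h2.
  rewrite (_ : _ - _ = ('X^p + 'X + (f b)%:P) ^+ p - ('X^p + 'X + (f b)%:P)).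
    by rewrite dvdp_sub ?gdp.
  by rewrite !PD -polyC_exp frob; ring.
have gXk k : g %| 'X^(p ^ k.*2) - 'X.
  elim: k => [|k IH]; first by rewrite expr1 subrr dvdp0.
  rewrite doubleS !expnSr !exprM.
  rewrite (_ : _ - _ = ('X^(p ^ k.*2) - 'X) ^+ p ^+ p + ('X^p ^+ p - 'X)).
    by rewrite dvdp_add // !dvdp_exp ?prime_gt0.
  by rewrite !(PD, PN); ring.
have := gXk l./2; have -> : (l./2).*2 = l by rewrite -[RHS](odd_double_half l) ol.
rewrite -cF finField_genPoly => gd.
have [m gm] := dvdp_prod_XsubC gd; have := eqp_size gm.
rewrite sg size_prod_XsubC; move: (mask m _) gm => s gm.
case: s gm => [//|x s] gm _; move: (rg x).
by rewrite (eqp_root gm) big_cons rootM root_XsubC eqxx.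
Qed.

(** * The trace function at prime powers *)

Lemma Fp_embedding (p l : nat) : prime p -> (0 < l)%N ->
  exists (F : finFieldType) (f : {rmorphism 'F_p -> F}), #|F| = (p ^ l)%N.
Proof.
move=> pp l0; have [F pF cF] := pPrimePowerField pp l0; exists F.
by exists (in_alg (pPrimeCharType pF) : {rmorphism 'F_p -> pPrimeCharType pF}).
Qed.

Lemma reduction_map (p : nat) (F : finFieldType) (f : {rmorphism 'F_p -> F})
    (V : weierstrass (padic_int p)) :
  reduction F V = map_weierstrass f (reduction 'F_p V).
Proof. by rewrite /reduction /map_weierstrass /= !rmorph_nat. Qed.

Lemma singular_point_map (K K' : fieldType) (f : {rmorphism K -> K'}) (V : weierstrass K) x y :
  singular_point V x y -> singular_point (map_weierstrass f V) (f x) (f y).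
Proof.
rewrite /singular_point /on_curve /= => /and3P[/eqP h1 /eqP h2 /eqP h3].
apply/and3P; split; apply/eqP.
- by move/(congr1 f): h1; rewrite !(rmorphD, rmorphM, rmorphXn).
- by move/(congr1 f): h2; rewrite !(rmorphD, rmorphM, rmorphXn, rmorphMn).
- by move/(congr1 f): h3; rewrite !(rmorphD, rmorphM, rmorphXn, rmorphMn, rmorph0).
Qed.

Section Trace.
Variable W : forall p : nat, weierstrass (padic_int p).
Variable t : nat -> int.
Hypothesis t_trace : is_trace_function W t.

Lemma trace_singular (p l : nat) (F : finFieldType) (f : {rmorphism 'F_p -> F}) x y :
  prime p -> (0 < l)%N -> #|F| = (p ^ l)%N -> singular_point (reduction 'F_p (W p)) x y ->
  t (p ^ l) = #|[set m | tangent_slope (reduction F (W p)) (f x) m]%SET|%:Z - 1.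
Proof.
move=> pp l0 cF /(singular_point_map f); rewrite -reduction_map => /npoints_singular E.
case: t_trace => _ _ /(_ p l F pp l0 cF) N.
rewrite -[X in X%:Z - 1](addKn (npoints (reduction F (W p)))) E cF.
move: E N; rewrite cF; lia.
Qed.

(** t(p^l) + 1 is the number of tangent slopes in the field with p^l elements
at a singular point defined over the prime field. *)
Lemma trace_bad (p l : nat) : prime p -> (0 < l)%N -> ~~ good_reduction (W p) ->
  t (p ^ l) = if split_reduction (W p) then 1
              else if multiplicative_reduction (W p) then (-1) ^+ l else 0.
Proof.
move=> pp l0 bad; have [F [f cF]] := Fp_embedding pp l0.
have slopeE x : tangent_slope (reduction F (W p)) (f x) =1 fun m =>
   m ^+ 2 + f (wa1 (reduction 'F_p (W p))) * m - f (x *+ 3 + wa2 (reduction 'F_p (W p))) == 0.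
  by move=> m; rewrite (reduction_map f) /tangent_slope /= rmorphD rmorphMn.
have tE x y : singular_point (reduction 'F_p (W p)) x y -> t (p ^ l) =
   #|[set m | m ^+ 2 + f (wa1 (reduction 'F_p (W p))) * m
              - f (x *+ 3 + wa2 (reduction 'F_p (W p))) == 0]%SET|%:Z - 1.
  move=> /(trace_singular f pp l0 cF) ->; congr (_%:Z - 1).
  by apply: eq_card => m; rewrite !inE slopeE.
have root_map b c m : m ^+ 2 + b * m - c == 0 -> f m ^+ 2 + f b * f m - f c == 0.
  by rewrite -rmorphXn -rmorphM -rmorphD -rmorphB fmorph_eq0.
have disc_map b c : (f b ^+ 2 + f c *+ 4 == 0) = (b ^+ 2 + c *+ 4 == 0).
  by rewrite -rmorphXn -rmorphMn -rmorphD fmorph_eq0.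
case: ifP => [/existsP[[x y] /andP[/andP[sxy dn0] /existsP[m ms]]]|nsplit].
  by rewrite (tE x y sxy) (card_quad_roots (root_map _ _ _ ms)) disc_map dn0.
case: ifP => [/existsP[[x y] /andP[sxy dn0]]|nmult].
  rewrite (tE x y sxy) (quad_nonsplit f pp cF dn0).
    rewrite -signr_odd; by case: odd.
  move=> m; apply/negP => ms; case/negP: (negbT nsplit).
  by apply/existsP; exists (x, y); rewrite /is_node sxy dn0; apply/existsP; exists m.
have [x [y sxy]] : exists x y, singular_point (reduction 'F_p (W p)) x y.
  by apply: disc0_singular; apply/eqP; move: bad; rewrite negbK.
have d0 : wa1 (reduction 'F_p (W p)) ^+ 2 + (x *+ 3 + wa2 (reduction 'F_p (W p))) *+ 4 == 0.
  apply/negPn/negP => dn0; case/negP: (negbT nmult).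
  by apply/existsP; exists (x, y); rewrite /is_node sxy dn0.
have [m ms] := quad_cusp_root (eqP d0).
by rewrite (tE x y sxy) (card_quad_roots (root_map _ _ _ ms)) disc_map d0.
Qed.

(** For each x, two solutions y of the equation have the sum
- (a1 x + a3) unless they are equal. *)
Lemma npoints_le (F : finFieldType) (V : weierstrass F) : (npoints V <= (#|F| * 2).+1)%N.
Proof.
rewrite /npoints ltnS.
have -> : #|[set P : F * F | on_curve V P.1 P.2]%SET| =
    (\sum_(x : F) #|[set y | on_curve V x y]%SET|)%N.
  rewrite -sum1_card (eq_bigl (fun P : F * F => on_curve V P.1 P.2)); last by move=> P; rewrite inE.
  rewrite -(pair_big_dep xpredT (fun x y => on_curve V x y) (fun _ _ => 1%N)) /=.
  by apply: eq_bigr => x _; rewrite -sum1_card; apply: eq_bigl => y; rewrite inE.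
rewrite -sum_nat_const; apply: leq_sum => x _.
case: (set_0Vmem [set y | on_curve V x y]%SET) => [->|[y]]; first by rewrite cards0.
rewrite inE /on_curve => /eqP yE.
apply: (@leq_trans #|[set y; - (wa1 V * x + wa3 V) - y]%SET|); last by rewrite cards2 ltnS leq_b1.
apply: subset_leq_card; apply/fintype.subsetP => z; rewrite !inE -yE -subr_eq0 => /eqP zE.
rewrite -subr_eq0 -(subr_eq0 z) -mulf_eq0 -zE; apply/eqP; ring.
Qed.

(** At a prime power q = p^l this is 1 <= N <= 2 q + 1; the general case
follows by multiplicativity. This bound, weaker than that of Hasse, holds
uniformly for good and bad primes, and gives absolute convergence for
Re w > 2, which is where T(w) is needed. *)
Lemma trace_le (n : nat) : (0 < n)%N -> (`|t n| <= n)%N.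
Proof.
case: t_trace => t1 tM tN; elim/ltn_ind: n => n IH n0.
have [->|nn1] := eqVneq n 1%N; first by rewrite t1.
have n1 : (1 < n)%N by rewrite ltn_neqAle eq_sym nn1.
have pp := pdiv_prime n1; set p := pdiv n in pp.
pose l := logn p n; pose m := (n %/ p ^ l)%N.
have l0 : (0 < l)%N by rewrite logn_gt0 mem_primes pp n0 pdiv_dvd.
have nE : n = (p ^ l * m)%N by rewrite mulnC divnK // pfactor_dvdnn.
have m0 : (0 < m)%N by move: n0; rewrite nE muln_gt0 => /andP[].
have pl1 : (1 < p ^ l)%N by rewrite -(exp1n l) ltn_exp2r // prime_gt1.
have cop : coprime (p ^ l) m.
  rewrite coprime_pexpl // prime_coprime //; apply/negP => /(dvdn_mul (dvdnn (p ^ l))).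
  by rewrite -nE -expnSr pfactor_dvdn // ltnn.
have tm : (`|t m| <= m)%N by apply: IH => //; rewrite nE ltn_Pmull.
have tp : (`|t (p ^ l)| <= p ^ l)%N.
  have [F [f cF]] := Fp_embedding pp l0.
  have := npoints_le (reduction F (W p)); have := tN p l F pp l0 cF.
  have : (0 < npoints (reduction F (W p)))%N by [].
  rewrite cF; lia.
rewrite [in t n]nE tM ?abszM ?(ltnW pl1) //.
by rewrite [leqRHS]nE leq_mul.
Qed.

End Trace.

(** * Minimal models and bad primes *)

Section Transformation.

Lemma wdisc_map (A B : comNzRingType) (f : {rmorphism A -> B}) (V : weierstrass A) :
  wdisc (map_weierstrass f V) = f (wdisc V).
Proof.
have e2 : wb2 (map_weierstrass f V) = f (wb2 V).
  by rewrite /wb2 rmorphD rmorphXn rmorphMn.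
have e4 : wb4 (map_weierstrass f V) = f (wb4 V).
  by rewrite /wb4 rmorphD rmorphM rmorphMn.
have e6 : wb6 (map_weierstrass f V) = f (wb6 V).
  by rewrite /wb6 rmorphD rmorphXn rmorphMn.
have e8 : wb8 (map_weierstrass f V) = f (wb8 V).
  by rewrite /wb8 rmorphB rmorphD rmorphB rmorphD rmorphMn !rmorphM.
rewrite /wdisc e2 e4 e6 e8.
move: (wb2 V) (wb4 V) (wb6 V) (wb8 V) => b2 b4 b6 b8.
rewrite rmorphD !rmorphB !rmorphMn !rmorphXn.
by rewrite !rmorphM rmorphN rmorphXn.
Qed.

Lemma wdisc_iso (K : fieldType) (V V' : weierstrass K) :
  weierstrass_iso V V' -> exists2 u, u != 0 & u ^+ 12 * wdisc V' = wdisc V.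
Proof.
move=> [u [r [s [w [u0 [h1 h2 h3 h4 h6]]]]]]; exists u => //.
pose V1 := Weierstrass (u * wa1 V') (u ^+ 2 * wa2 V') (u ^+ 3 * wa3 V')
  (u ^+ 4 * wa4 V') (u ^+ 6 * wa6 V').
have -> : u ^+ 12 * wdisc V' = wdisc V1.
  by rewrite /wdisc /wb2 /wb4 /wb6 /wb8 /=; ring.
have e2 : wb2 V1 = wb2 V + 12 * r by rewrite /wb2 /= h1 h2; ring.
have e4 : wb4 V1 = wb4 V + r * wb2 V + 6 * r ^+ 2.
  by rewrite /wb4 /wb2 /= h1 h3 h4; ring.
have e6 : wb6 V1 = wb6 V + 2 * r * wb4 V + r ^+ 2 * wb2 V + 4 * r ^+ 3.
  by rewrite /wb4 /wb2 /wb6 /= h3 h6; ring.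
have e8 : wb8 V1 = wb8 V + 3 * r * wb6 V + 3 * r ^+ 2 * wb4 V + r ^+ 3 * wb2 V + 3 * r ^+ 4.
  by rewrite /wb8 /wb4 /wb2 /wb6 /= h1 h2 h3 h4 h6; ring.
have rel : 4 * wb8 V = wb2 V * wb6 V - wb4 V ^+ 2.
  by rewrite /wb8 /wb4 /wb2 /wb6; ring.
rewrite /wdisc e2 e4 e6 e8; move: (wb2 V) (wb4 V) (wb6 V) (wb8 V) rel => b2 b4 b6 b8 rel.
(* The two sides agree only modulo 4 b8 = b2 b6 - b4^2; the multiplier is their quotient. *)
rewrite -[RHS]addr0 -(mul0r (- 36 * r ^+ 2 - 6 * r * b2)) -(subrr (4 * b8)) {2}rel; ring.
Qed.

End Transformation.

Section Padic.
Variable p : nat.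
Hypothesis pp : prime p.

Lemma residue_natr n k : (n%:R : padic_int p) k = (n %% prime_base p ^ k)%N.
Proof.
elim: n => [//|n IH]; rewrite -addn1 natrD.
by rewrite -modnDm -IH.
Qed.

Lemma padic_pchar0 : [pchar (padic_int p)] =i pred0.
Proof.
apply/pcharf0P => n; case: n => [|n]; first by rewrite !eqxx.
apply/negbTE/eqP => /(congr1 (fun x : padic_int p => x n.+1)).
rewrite residue_natr /= mod0n modn_small //.
by rewrite ltn_expl // prime_gt1 // prime_base_prime.
Qed.

(** The reduction of an equation is its image under this map, so that, the map
being a ring morphism, discriminants commute with reduction. *)
Definition residue_Fp (x : padic_int p) : 'F_p := (x 1)%:R.

Let natr_mod n : (n %% prime_base p ^ 1)%N%:R = n%:R :> 'F_p.
Proof. by rewrite expn1 prime_baseE // Fp_nat_mod. Qed.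

Fact residue_Fp_is_additive : {morph residue_Fp : x y / x - y}.
Proof.
suff add : {morph residue_Fp : x y / x + y}.
  by move=> x y; apply/eqP; rewrite eq_sym subr_eq -add subrK.
by move=> x y; rewrite /residue_Fp /= natr_mod natrD.
Qed.

Fact residue_Fp_is_multiplicative : monoid_morphism residue_Fp.
Proof.
split; first by rewrite /residue_Fp /= natr_mod.
by move=> x y; rewrite /residue_Fp /= natr_mod natrM.
Qed.

HB.instance Definition _ :=
  GRing.isZmodMorphism.Build (padic_int p) 'F_p residue_Fp residue_Fp_is_additive.
HB.instance Definition _ :=
  GRing.isMonoidMorphism.Build (padic_int p) 'F_p residue_Fp residue_Fp_is_multiplicative.

(** Together with the next lemma: over a model with nonzero discriminant, good
reduction is the vanishing of the valuation of the discriminant. *)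
Lemma good_reductionE (V : weierstrass (padic_int p)) :
  good_reduction V = (wdisc V 1 != 0)%N.
Proof.
rewrite /good_reduction /is_elliptic -[reduction 'F_p V]/(map_weierstrass residue_Fp V).
rewrite wdisc_map /residue_Fp; congr negb.
have := residue_id (wdisc V) 1; rewrite expn1 prime_baseE // => <-.
by rewrite -val_Fp_nat // -[in RHS](inj_eq val_inj) /=; rewrite natr_Zp.
Qed.

Lemma padic_val0 (x : padic_int p) : x != 0 -> (padic_val x == 0)%N = (x 1 != 0)%N.
Proof.
move=> /padic_neq0P xn0; rewrite /padic_val; case: pselect => // e.
case: ex_minnP => n xn n_min; have x0 : x 0 = 0%N by rewrite -(residue_id x 0) modn1.
(* The residue of index 0 is 0, so the least index n with a nonzero residue is at least 1. *)
case: n xn n_min => [|[|n]] xn n_min /=; first by rewrite x0 in xn.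
  by rewrite xn.
by apply/esym/negbTE; apply/negP => x1; have := n_min _ x1.
Qed.

End Padic.

Lemma scaled_rat_int (x : rat) (d k : nat) :
  (`|denq x| %| d)%N -> (0 < k)%N -> exists z : int, z%:~R = d%:R ^+ k * x.
Proof.
move=> /dvdnP[e ->]; case: k => // k _.
exists (e%:Z * (e%:Z * denq x) ^+ k * numq x).
have dE : (`|denq x|%N)%:R = (denq x)%:~R :> rat.
  by rewrite pmulrn absz_denq.
rewrite natrM dE.
transitivity ((e%:R * (denq x)%:~R) ^+ k.+1 * ((numq x)%:~R / (denq x)%:~R) : rat); last first.
  by rewrite divq_num_den.
rewrite !rmorphM rmorphXn rmorphM /= exprS.
have : (denq x)%:~R != 0 :> rat by rewrite intr_eq0 denq_eq0.
by rewrite -pmulrn => n0; field.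
Qed.

(** Scaling a_i by d^i is a change of variables; with d a multiple of all the
denominators it gives integer coefficients. *)
Lemma integral_scaling (E : weierstrass rat) :
  exists (V : weierstrass int) (d : nat), (0 < d)%N /\
  [/\ (wa1 V)%:~R = d%:R * wa1 E, (wa2 V)%:~R = d%:R ^+ 2 * wa2 E,
      (wa3 V)%:~R = d%:R ^+ 3 * wa3 E, (wa4 V)%:~R = d%:R ^+ 4 * wa4 E
    & (wa6 V)%:~R = d%:R ^+ 6 * wa6 E].
Proof.
pose d := (`|denq (wa1 E)| * (`|denq (wa2 E)| * (`|denq (wa3 E)|
  * (`|denq (wa4 E)| * `|denq (wa6 E)|))))%N.
have scale x k : (`|denq x| %| d)%N -> (0 < k)%N -> exists z : int, z%:~R = d%:R ^+ k * x.
  exact: scaled_rat_int.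
have [z1 h1] := scale (wa1 E) 1%N (dvdn_mulr _ (dvdnn _)) isT.
have [z2 h2] := scale (wa2 E) 2 (dvdn_mull _ (dvdn_mulr _ (dvdnn _))) isT.
have [z3 h3] : exists z : int, z%:~R = d%:R ^+ 3 * wa3 E.
  by apply: scale => //; do 2!apply: dvdn_mull; exact: dvdn_mulr.
have [z4 h4] : exists z : int, z%:~R = d%:R ^+ 4 * wa4 E.
  by apply: scale => //; do 3!apply: dvdn_mull; exact: dvdn_mulr.
have [z6 h6] : exists z : int, z%:~R = d%:R ^+ 6 * wa6 E.
  by apply: scale => //; do 4!apply: dvdn_mull.
exists (Weierstrass z1 z2 z3 z4 z6), d; split=> //.
by rewrite !muln_gt0 !absz_gt0 !denq_neq0.
Qed.

Lemma weierstrass_iso_scaling (K : fieldType) (V V' : weierstrass K) (d : K) : d != 0 ->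
  [/\ wa1 V' = d * wa1 V, wa2 V' = d ^+ 2 * wa2 V, wa3 V' = d ^+ 3 * wa3 V,
      wa4 V' = d ^+ 4 * wa4 V & wa6 V' = d ^+ 6 * wa6 V] -> weierstrass_iso V V'.
Proof.
move=> d0 [e1 e2 e3 e4 e6]; exists d^-1, 0, 0, 0; split; first by rewrite invr_eq0.
by rewrite e1 e2 e3 e4 e6; split; field.
Qed.

(** In characteristic 0 the canonical map from the rationals to K respects the
relation between an integer and a multiple of x, because the denominator of x
stays invertible. *)
Lemma ratr_scaling (K : fieldType) (z : int) (d k : nat) (x : rat) :
  [pchar K] =i pred0 -> z%:~R = d%:R ^+ k * x -> z%:~R = d%:R ^+ k * ratr x :> K.
Proof.
move=> K0 zE; have n0 : (denq x)%:~R != 0 :> rat by rewrite intr_eq0 denq_neq0.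
have n0K : (denq x)%:~R != 0 :> K.
  by rewrite -absz_denq -pmulrn ((pcharf0P _).1 K0) absz_eq0 denq_neq0.
have : z * denq x = d%:Z ^+ k * numq x.
  apply: (@intr_inj rat); rewrite !rmorphM rmorphXn /= zE -pmulrn -{1}(divq_num_den x).
  by rewrite -mulrA divfK.
move=> /(congr1 (fun y : int => y%:~R : K)); rewrite !rmorphM rmorphXn /= -pmulrn => e.
by rewrite /ratr mulrA -e mulfK.
Qed.

(** The integral scaling of E is a model over Z_p for every p. At a prime that
does not divide its discriminant its valuation is 0, so that of a minimal
model is 0 too. *)
Lemma bad_primes_finite (E : weierstrass rat) (W : forall p : nat, weierstrass (padic_int p)) :
  is_elliptic E -> (forall p, prime p -> minimal_model E (W p)) ->
  finite_set (bad_primes W).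
Proof.
move=> Ell Wmin; have [V [d [d0 VE]]] := integral_scaling E.
have [a1 a2 a3 a4 a6] := VE.
have VQ : weierstrass_iso E (map_weierstrass intr V : weierstrass rat).
  by apply: (@weierstrass_iso_scaling _ _ _ d%:R); rewrite ?pnatr_eq0 -?lt0n.
have D0 : wdisc V != 0.
  have [u u0 uE] := wdisc_iso VQ; move: Ell; rewrite /is_elliptic -uE wdisc_map.
  by rewrite mulf_eq0 negb_or intr_eq0 => /andP[].
have [n nE] : exists n, n = `|wdisc V|%N by eexists.
suff le_n p : prime p -> ~~ good_reduction (W p) -> (p < n.+1)%N.
  by apply: (@sub_finite_set _ _ `I_n.+1); [move=> p []; exact: le_n|exact: finite_II].
move=> pp bad; rewrite ltnS; apply: dvdn_leq; first by rewrite nE absz_gt0.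
apply/negPn/negP => npn; case/negP: bad.
have [iso vmin] := Wmin p pp.
have K0 : [pchar (padic_num p)] =i pred0.
  apply/pcharf0P => m; rewrite -(rmorph_nat (@FracField.tofrac (padic_int p))) tofrac_eq0.
  exact: ((pcharf0P _).1 (padic_pchar0 p)).
pose Vp : weierstrass (padic_int p) := map_weierstrass intr V.
have isoV : integral_model E Vp.
  have dK : d%:R != 0 :> padic_num p by rewrite ((pcharf0P _).1 K0) -lt0n.
  apply: (weierstrass_iso_scaling dK); rewrite /= !rmorph_int.
  rewrite (ratr_scaling K0 a2) (ratr_scaling K0 a3) (ratr_scaling K0 a4) (ratr_scaling K0 a6).
  by split=> //; rewrite (@ratr_scaling _ _ _ 1 _ K0 a1).
have DVp : (wdisc Vp 1 != 0)%N.
  rewrite -good_reductionE // /good_reduction /is_elliptic.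
  rewrite -[reduction 'F_p Vp]/(map_weierstrass (@residue_Fp p) Vp) wdisc_map.
  rewrite wdisc_map rmorph_int; rewrite -(dvdz_pcharf (pchar_Fp pp)).
  by move: npn; rewrite nE.
have DVp0 : wdisc Vp != 0 by apply: contraNneq DVp => ->; rewrite /= mod0n.
have DW0 : wdisc (W p) != 0.
  have [u u0 uE] := wdisc_iso iso; have [v v0 vE] := wdisc_iso isoV.
  apply: contra DVp0 => /eqP e; move: uE; rewrite wdisc_map e rmorph0 mulr0 -vE => /esym/eqP.
  by rewrite wdisc_map mulf_eq0 expf_eq0 (negbTE v0) /= tofrac_eq0.
rewrite good_reductionE // -padic_val0 // -leqn0.
by rewrite (leq_trans (vmin _ isoV)) // leqn0 padic_val0.
Qed.

(** * Series of complex numbers *)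

Import Normc.

Section ComplexSeries.
Variable R : realType.
Local Notation C := R[i].
Implicit Types (f g : nat -> C) (z w l : C).

Lemma normE z : `|z| = (normc z)%:C%C. Proof. by []. Qed.

Lemma normc_ge0 z : 0 <= normc z.
Proof. by rewrite -lecR -normE normr_ge0. Qed.

Lemma normc_triangle z w : normc (z + w) <= normc z + normc w.
Proof. by rewrite -lecR rmorphD; exact: (@ler_normD _ R[i] z w). Qed.

Lemma normc_opp z : normc (- z) = normc z.
Proof. by apply: complexI; exact: (@normrN R[i] R[i] z). Qed.

Lemma normc_distC z w : normc (z - w) = normc (w - z).
Proof. by rewrite -normc_opp opprB. Qed.

Lemma normcX z n : normc (z ^+ n) = normc z ^+ n.
Proof. by elim: n => [|n IH]; rewrite ?expr0 ?normc1 // !exprS normcM IH. Qed.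

Lemma normc_real (x : R) : normc x%:C%C = `|x|.
Proof. by rewrite /normc /= expr0n addr0 sqrtr_sqr. Qed.

Lemma normc_gt0 z : (0 < normc z) = (z != 0).
Proof. by rewrite -ltcR -normE normr_gt0. Qed.

Lemma le_normc_sum (I : Type) (s : seq I) (P : pred I) (F : I -> C) :
  normc (\sum_(i <- s | P i) F i) <= \sum_(i <- s | P i) normc (F i).
Proof.
elim/big_ind2: _ => [|x a y b xa yb|//]; first by rewrite normc0.
by rewrite (le_trans (normc_triangle _ _)) // lerD.
Qed.

Lemma Re_sum (I : Type) (s : seq I) (P : pred I) (F : I -> C) :
  complex.Re (\sum_(i <- s | P i) F i) = \sum_(i <- s | P i) complex.Re (F i).
Proof. by apply: (big_morph (@complex.Re R)) => // -[a b] [c d]. Qed.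

Lemma Im_sum (I : Type) (s : seq I) (P : pred I) (F : I -> C) :
  complex.Im (\sum_(i <- s | P i) F i) = \sum_(i <- s | P i) complex.Im (F i).
Proof. by apply: (big_morph (@complex.Im R)) => // -[a b] [c d]. Qed.

Lemma normc_le_ReIm z : normc z <= `|complex.Re z| + `|complex.Im z|.
Proof.
rewrite [z in leLHS]complexE (le_trans (normc_triangle _ _)) // normcM !normc_real.
by rewrite [normc 'i%C]/= expr0n expr1n add0r sqrtr1 mul1r.
Qed.

Lemma normc_ge_Re z : `|complex.Re z| <= normc z.
Proof. by rewrite -lecR -normE; exact: normc_ge_Re. Qed.

Lemma normc_ge_Im z : `|complex.Im z| <= normc z.
Proof.
by case: z => a b /=; rewrite -(sqrtr_sqr b) ler_wsqrtr // lerDr sqr_ge0.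
Qed.

Lemma cvgC_dist (u : nat -> C) l :
  u @ \oo --> l <-> (fun n => normc (u n - l)) @ \oo --> (0 : R).
Proof.
split=> [/cvgrPdist_lt ul|/cvgrPdist_lt ul]; apply/cvgrPdist_lt => e e0.
  have := ul e%:C%C; rewrite ltcR => /(_ e0) [N _ uN]; exists N => // n /uN /=.
  by rewrite normE ltcR sub0r normrN ger0_norm ?normc_ge0 // normc_distC.
case: e e0 => e i; rewrite ltcE /= => /andP[/eqP -> e0].
have [N _ uN] := ul e e0; exists N => // n /uN /=.
by rewrite normE sub0r normrN ger0_norm ?normc_ge0 // normc_distC (ltcR _ e).
Qed.

Lemma cvgC_squeeze (u : nat -> C) l (e : nat -> R) :
  (forall n, normc (u n - l) <= e n) -> e @ \oo --> (0 : R) -> u @ \oo --> l.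
Proof.
move=> ue e0; apply/cvgC_dist; apply: (@squeeze_cvgr _ _ _ _ (fun=> 0) e) => //.
  by near=> n; rewrite normc_ge0 ue.
exact: cvg_cst.
Unshelve. all: by end_near. Qed.

Lemma normc_dist_le z w : `|normc z - normc w| <= normc (z - w).
Proof.
have h1 := normc_triangle (z - w) w; have h2 := normc_triangle (w - z) z.
by move: h1 h2; rewrite !subrK (normc_distC w) ler_norml => h1 h2; apply/andP; split; lra.
Qed.

Lemma cvgC_norm (u : nat -> C) l : u @ \oo --> l ->
  (fun n => normc (u n)) @ \oo --> normc l.
Proof.
move=> /cvgC_dist ul; apply/subr_cvg0/norm_cvg0P.
apply: (@squeeze_cvgr _ _ _ _ (fun=> 0) (fun n => normc (u n - l))) => //; last exact: cvg_cst.
by near=> n; rewrite normr_ge0 normc_dist_le.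
Unshelve. all: by end_near. Qed.

Lemma cvgC_eq (u v : nat -> C) l : u =1 v -> u @ \oo --> l -> v @ \oo --> l.
Proof. by move=> /funext ->. Qed.

Lemma cvgC_cst l : (fun _ : nat => l) @ \oo --> l.
Proof. exact: cvg_cst. Qed.

Lemma cvgC_M (u v : nat -> C) l l' :
  u @ \oo --> l -> v @ \oo --> l' -> (fun n => u n * v n) @ \oo --> l * l'.
Proof. by move=> ul vl; exact: (@cvgM (R[i] : numFieldType) nat \oo _ u v l l' ul vl). Qed.

Lemma cvgC_D (u v : nat -> C) l l' :
  u @ \oo --> l -> v @ \oo --> l' -> (fun n => u n + v n) @ \oo --> l + l'.
Proof.
move=> ul vl.
exact: (@cvgD (R[i] : numFieldType) (R[i] : normedModType R[i]) nat \oo _ u v l l' ul vl).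
Qed.

Lemma cvgC_B (u v : nat -> C) l l' :
  u @ \oo --> l -> v @ \oo --> l' -> (fun n => u n - v n) @ \oo --> l - l'.
Proof.
move=> ul vl.
exact: (@cvgB (R[i] : numFieldType) (R[i] : normedModType R[i]) nat \oo _ u v l l' ul vl).
Qed.

Lemma cvgC_ReIm (u : nat -> C) (a b : R) :
  (fun n => complex.Re (u n)) @ \oo --> a -> (fun n => complex.Im (u n)) @ \oo --> b ->
  u @ \oo --> (a +i* b)%C.
Proof.
move=> ua ub.
apply: (@cvgC_squeeze _ _ (fun n => `|complex.Re (u n) - a| + `|complex.Im (u n) - b|)).
  by move=> n; rewrite (le_trans (normc_le_ReIm _)) //; case: (u n).
rewrite -[0]addr0; apply: cvgD; apply/norm_cvg0P/subr_cvg0 => //.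
Qed.

Lemma cvgC_unique (u : nat -> C) l l' : u @ \oo --> l -> u @ \oo --> l' -> l = l'.
Proof.
move=> ul ul'; rewrite -(cvg_lim (@norm_hausdorff _ _) ul).
exact: (cvg_lim (@norm_hausdorff _ _) ul').
Qed.

Definition anorm f (n : nat) : R := normc (f n).
Definition csum (m : nat) f (M : nat) : C := \sum_(m <= n < M) f n.
Definition rsum (m : nat) (v : nat -> R) (M : nat) : R := \sum_(m <= n < M) v n.

Lemma psum_nondecreasing (m : nat) (v : nat -> R) : (forall n, 0 <= v n) ->
  {homo rsum m v : a b / (a <= b)%N >-> a <= b}.
Proof.
move=> v0; apply: homo_leq => [//|x y z|M]; first exact: le_trans.
rewrite /rsum; case: (leqP m M) => mM; first by rewrite big_nat_recr //= lerDl.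
by rewrite !big_geq // ltnW.
Qed.

(** Bounded partial sums of nonnegative reals converge; together with
[bounded_psum_cvg] this reduces every convergence question below to a bound on
the sums of absolute values. *)
Lemma psum_cvg (m : nat) (v : nat -> R) (B : R) : (forall n, 0 <= v n) ->
  (forall M, rsum m v M <= B) -> cvgn (rsum m v).
Proof.
move=> v0 vB; apply: nondecreasing_is_cvgn; first exact: psum_nondecreasing.
by exists B => _ [M _ <-].
Qed.

Definition bounded_psum (m : nat) f (B : R) : Prop :=
  forall M, rsum m (anorm f) M <= B.

(** If h is the real or the imaginary part, the terms h(f n) + abs(f n) are
nonnegative and at most 2 abs(f n), so their sums converge, and so do those of
h(f n). *)
Lemma bounded_psum_cvg (m : nat) f B : bounded_psum m f B -> cvgn (csum m f).
Proof.
move=> fB.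
have half (h : C -> R) : (forall z, `|h z| <= normc z) ->
    cvgn (rsum m (h \o f)).
  move=> hz; have c1 : cvgn (rsum m (fun n => h (f n) + normc (f n))).
    apply: (@psum_cvg _ _ (B + B)) => [n|M].
      by have := hz (f n); rewrite ler_norml => /andP[]; lra.
    rewrite /rsum big_split /= lerD // (le_trans _ (fB M)) // ler_sum // => n _.
    exact: le_trans (ler_norm _) (hz _).
  have c2 : cvgn (rsum m (anorm f)).
    by apply: (@psum_cvg _ _ B) => [n|//]; exact: normc_ge0.
  have := cvgB c1 c2; set l := (X in _ --> X) => c.
  apply/cvg_ex; exists l.
  suff -> : rsum m (h \o f) =
      rsum m (fun n => h (f n) + normc (f n)) - rsum m (anorm f) by exact: c.
  apply/funext => M.
  transitivity (rsum m (fun n => h (f n) + normc (f n)) M - rsum m (anorm f) M) => //.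
  by rewrite /rsum -sumrB; apply: eq_bigr => n _; rewrite /anorm addrK.
have cR := half _ normc_ge_Re; have cI := half _ normc_ge_Im.
apply/cvg_ex; eexists; apply: cvgC_ReIm.
  rewrite (_ : (fun n => _) = rsum m (@complex.Re R \o f)); first exact: cR.
  by apply/funext => M; rewrite /csum Re_sum.
rewrite (_ : (fun n => _) = rsum m (@complex.Im R \o f)); first exact: cI.
by apply/funext => M; rewrite /csum Im_sum.
Qed.

Section Cauchy.
Variable K : comNzRingType.
Implicit Types a b : nat -> K.

(** Summing over n the terms on the antidiagonals i + j = n, for n < M, is
summing for each i over the j < M - i. *)
Lemma convolution_sum a b M :
  \sum_(0 <= n < M) \sum_(i < n.+1) a i * b (n - i)%N =
  \sum_(i < M) a i * \sum_(0 <= j < M - i) b j.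
Proof.
elim: M => [|M IH]; first by rewrite big_geq // big_ord0.
rewrite big_nat_recr //= IH [RHS]big_ord_recr /= subSn // subnn big_nat1.
rewrite [X in _ + X]big_ord_recr /= subnn addrA; congr (_ + _).
rewrite -big_split /=; apply: eq_bigr => i _.
by rewrite -mulrDr subSn ?(ltnW (ltn_ord i)) // big_nat_recr.
Qed.

Lemma convolution_sum_sub a b M :
  (\sum_(0 <= i < M) a i) * (\sum_(0 <= j < M) b j)
    - \sum_(0 <= n < M) \sum_(i < n.+1) a i * b (n - i)%N =
  \sum_(i < M) a i * \sum_(M - i <= j < M) b j.
Proof.
rewrite convolution_sum big_mkord mulr_suml -sumrB; apply: eq_bigr => i _.
rewrite -mulrBr; congr (_ * _).
by rewrite [X in X - _](big_cat_nat (n := (M - i)%N)) ?leq_subr //= addrAC subrr add0r.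
Qed.

End Cauchy.

Lemma cvg_half : (fun n => n./2) @ \oo --> \oo.
Proof.
rewrite (_ : (fun n => _) = fun n => (n %/ 2)%N); first exact: cvg_divnr.
by apply/funext => n; rewrite divn2.
Qed.

Definition convolution f g (n : nat) : C := \sum_(i < n.+1) f i * g (n - i)%N.

(** The product of the partial sums up to M exceeds the partial sum of the
convolution by the terms with i + j >= M. In absolute value they are bounded
by the terms of the square [0, M[^2 outside the square [0, M/2[^2, since the
latter is below the antidiagonal. *)
Lemma cvg_convolution f g (A B : C) (a b : R) : bounded_psum 0 f a -> bounded_psum 0 g b ->
  csum 0 f @ \oo --> A -> csum 0 g @ \oo --> B ->
  csum 0 (convolution f g) @ \oo --> A * B.
Proof.
move=> fa gb fA gB.
pose F := rsum 0 (anorm f); pose G := rsum 0 (anorm g).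
have PAB := cvgC_M fA gB.
have Fc : cvgn F by apply: psum_cvg fa => n; exact: normc_ge0.
have Gc : cvgn G by apply: psum_cvg gb => n; exact: normc_ge0.
have F0 : (fun M => F M * G M - F M./2 * G M./2) @ \oo --> (0 : R).
  rewrite -(subrr (limn F * limn G)).
  have FG : (F \* G) @ \oo --> limn F * limn G by apply: cvgM.
  exact: (@cvgB _ _ _ _ _ (F \* G) _ _ _ FG (cvg_comp _ _ cvg_half FG)).
have D0 : (fun M => csum 0 f M * csum 0 g M - csum 0 (convolution f g) M) @ \oo --> (0 : C).
  apply: cvgC_squeeze F0 => M; rewrite subr0 /csum /convolution convolution_sum_sub.
  apply: le_trans (le_normc_sum _ _ _) _.
  apply: (@le_trans _ _ (\sum_(i < M) normc (f i) * \sum_(M - i <= j < M) normc (g j))).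
    by apply: ler_sum => i _; rewrite normcM ler_wpM2l ?normc_ge0 // le_normc_sum.
  rewrite -(convolution_sum_sub (anorm f) (anorm g)) lerD2l lerN2 convolution_sum.
  apply: (@le_trans _ _
    (rsum 0 (fun i => normc (f i) * rsum 0 (anorm g) (M - i)) M./2)); last first.
    rewrite -(big_mkord xpredT (fun i => normc (f i) * rsum 0 (anorm g) (M - i))).
    apply: psum_nondecreasing; last by lia.
    by move=> n; rewrite mulr_ge0 ?normc_ge0 // sumr_ge0 // => j _; rewrite normc_ge0.
  rewrite /F /rsum mulr_suml; apply: ler_sum_nat => i /andP[_ iM].
  rewrite ler_wpM2l ?normc_ge0 //; apply: (@psum_nondecreasing 0 (anorm g)); last by lia.
  by move=> n; rewrite normc_ge0.
have := cvgC_B PAB D0; rewrite subr0; apply: cvgC_eq => M.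
by rewrite opprB addrC subrK.
Qed.

End ComplexSeries.

(** * The complex exponential and powers of integers *)

Section ComplexExp.
Variable R : realType.
Local Notation C := R[i].
Implicit Types (z w : C) (x y : R).

Definition exp_term z (n : nat) : C := z ^+ n / n`!%:R.

Lemma natC n : (n%:R : R)%:C%C = n%:R :> C.
Proof. by rewrite rmorph_nat. Qed.

Lemma normc_nat n : normc (n%:R : C) = n%:R.
Proof. by rewrite -natC normc_real ger0_norm. Qed.

Lemma normc_exp_term z n : anorm (exp_term z) n = exp_coeff (normc z) n.
Proof. by rewrite /anorm /exp_term normcM normcX normcV normc_nat. Qed.

Lemma exp_term_bounded z : bounded_psum 0 (exp_term z) (expR (normc z)).
Proof.
move=> M; rewrite (_ : rsum _ _ _ = series (exp_coeff (normc z)) M); last first.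
  by apply: eq_bigr => n _; exact: normc_exp_term.
apply: nondecreasing_cvgn_le; last exact: is_cvg_series_exp_coeff.
apply: (@nondecreasing_series _ _ xpredT 0) => n _ _.
by rewrite /exp_coeff /= divr_ge0 ?exprn_ge0 ?normc_ge0.
Qed.

Lemma exp_term_real_cvg x : csum 0 (exp_term x%:C%C) @ \oo --> (expR x)%:C%C.
Proof.
have E M : csum 0 (exp_term x%:C%C) M = (series (exp_coeff x) M)%:C%C.
  rewrite /csum /series /= rmorph_sum; apply: eq_bigr => n _.
  by rewrite /exp_term /exp_coeff /= rmorphM rmorphXn fmorphV rmorph_nat.
apply: cvgC_ReIm.
  rewrite (_ : (fun n => _) = series (exp_coeff x)); first exact: is_cvg_series_exp_coeff.
  by apply/funext => M; rewrite E.
rewrite (_ : (fun n => _) = fun=> 0); first exact: cvg_cst.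
by apply/funext => M; rewrite E.
Qed.

(** The powers of i have period 4: (i y)^n is (-1)^(n/2) y^n for even n, and
i (-1)^((n-1)/2) y^n for odd n. *)
Lemma exp_term_imE y n : exp_term ('i%C * y%:C%C) n = (cos_coeff y n +i* sin_coeff y n)%C.
Proof.
have -> : exp_term ('i%C * y%:C%C) n = 'i%C ^+ n * (y ^+ n / n`!%:R)%:C%C.
  by rewrite /exp_term exprMn -mulrA; congr (_ * _); rewrite rmorphM rmorphXn fmorphV rmorph_nat.
have -> : 'i%C ^+ n = (if odd n then (0 +i* (-1) ^+ n./2)%C else ((-1) ^+ n./2)%:C%C) :> C.
  rewrite -{1}(odd_double_half n) exprD -mul2n exprM sqr_i.
  have -> : (-1) ^+ n./2 = ((-1) ^+ n./2 : R)%:C%C :> C by rewrite rmorphXn rmorphN1.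
  case: (odd n) => /=; rewrite ?expr1 ?expr0 ?mul1r //.
  by apply/eqP; rewrite eq_complex /= !mul0r !mul1r subr0 add0r !eqxx.
rewrite /cos_coeff /sin_coeff /= -exprnP.
case on : (odd n) => /=; apply/eqP;
  rewrite eq_complex /= ?mul0r ?mulr0 ?mul1r ?subr0 ?addr0 ?add0r ?mulrA ?eqxx //.
suff -> : n.-1./2 = n./2 by rewrite eqxx.
by case: n on => //= n; rewrite uphalf_half => /negbTE ->.
Qed.

Lemma exp_term_im_cvg y : csum 0 (exp_term ('i%C * y%:C%C)) @ \oo --> (cos y +i* sin y)%C.
Proof.
apply: cvgC_ReIm.
  rewrite (_ : (fun n => _) = series (cos_coeff y)); first by
    rewrite unlock; exact: is_cvg_series_cos_coeff.
  by apply/funext => M; rewrite /csum Re_sum; apply: eq_bigr => n _; rewrite exp_term_imE.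
rewrite (_ : (fun n => _) = series (sin_coeff y)); first by
  rewrite unlock; exact: is_cvg_series_sin_coeff.
by apply/funext => M; rewrite /csum Im_sum; apply: eq_bigr => n _; rewrite exp_term_imE.
Qed.

(** The exponential is defined by real functions of the two coordinates; its
power series is the Cauchy product of those of e^x and of e^(i y), by the
binomial formula. *)
Lemma cexp_cvg z : csum 0 (exp_term z) @ \oo --> cexp z.
Proof.
have := cvg_convolution (@exp_term_bounded _) (@exp_term_bounded _)
  (@exp_term_real_cvg (complex.Re z)) (@exp_term_im_cvg (complex.Im z)).
rewrite (_ : (expR _)%:C%C * _ = cexp z); last first.
  by apply/eqP; rewrite eq_complex /= !mul0r subr0 addr0 !eqxx.
apply: cvgC_eq => M; apply: eq_bigr => n _; rewrite /convolution /exp_term.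
rewrite [in RHS](complexE z) exprDn mulr_suml (reindex_inj rev_ord_inj) /=.
apply: eq_bigr => i _; have := ltn_ord i; rewrite ltnS => ni.
rewrite subSS subKn // mulrAC.
have -> : n`!%:R = 'C(n, i)%:R * (i`!%:R * (n - i)`!%:R) :> C by rewrite -!natrM bin_fact.
have f0 k : k`!%:R != 0 :> C by rewrite pnatr_eq0 -lt0n fact_gt0.
have b0 : 'C(n, i)%:R != 0 :> C by rewrite pnatr_eq0 -lt0n bin_gt0.
rewrite -mulr_natr; field.
by rewrite !f0 b0.
Qed.

Lemma cexpD z w : cexp (z + w) = cexp z * cexp w.
Proof.
case: z w => a b [c d]; apply/eqP; rewrite eq_complex /= expRD cosD sinD.
by apply/andP; split; apply/eqP; ring.
Qed.

Lemma cexp0 : cexp 0 = 1 :> C.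
Proof. by apply/eqP; rewrite eq_complex /= expR0 cos0 sin0 mulr0 mul1r !eqxx. Qed.

Lemma cexpMn z n : cexp (z *+ n) = cexp z ^+ n.
Proof. by elim: n => [|n IH]; rewrite ?mulr0n ?cexp0 // mulrS cexpD IH exprS. Qed.

Lemma cexp_real x : cexp x%:C%C = (expR x)%:C%C.
Proof. by apply/eqP; rewrite eq_complex /= cos0 sin0 mulr1 mulr0 !eqxx. Qed.

Lemma normc_cexp z : normc (cexp z) = expR (complex.Re z).
Proof.
rewrite /normc /= !exprMn -mulrDr cos2Dsin2 mulr1 sqrtr_sqr.
by rewrite ger0_norm // expR_ge0.
Qed.

Lemma npowD n z w : npow n (z + w) = npow n z * npow n w.
Proof. by rewrite /npow mulrDl cexpD. Qed.

Lemma npow1n z : npow 1 z = 1.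
Proof. by rewrite /npow ln1 mulr0 cexp0. Qed.

Lemma npowM m n z : (0 < m)%N -> (0 < n)%N -> npow (m * n) z = npow m z * npow n z.
Proof.
move=> m0 n0; rewrite /npow natrM lnM ?posrE ?ltr0n //.
by rewrite rmorphD mulrDr cexpD.
Qed.

Lemma npowX p l z : (0 < p)%N -> npow (p ^ l) z = npow p z ^+ l.
Proof.
move=> p0; elim: l => [|l IH]; first by rewrite npow1n.
by rewrite expnS npowM ?expn_gt0 ?p0 // IH exprS.
Qed.

Lemma npow_1 n : (0 < n)%N -> npow n 1 = n%:R :> C.
Proof. by move=> n0; rewrite /npow mul1r cexp_real lnK ?posrE ?ltr0n // natC. Qed.

Lemma npow_muln n z k : npow n (z *+ k) = npow n z ^+ k.
Proof. by rewrite /npow mulrnAl cexpMn. Qed.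

Lemma normc_npow n z : (0 < n)%N -> normc (npow n z) = n%:R `^ complex.Re z.
Proof.
move=> n0; rewrite /npow normc_cexp /powR pnatr_eq0 eqn0Ngt n0 /=.
by case: z => a b /=; rewrite !mulr0 subr0.
Qed.

End ComplexExp.

(** * Euler products *)

Section EulerProduct.

(** All products of powers p^l, l < K, of the primes p of a list: the integers
that occur when the product of the truncated Euler factors is expanded. *)
Fixpoint smooth (K : nat) (ps : seq nat) : seq nat :=
  if ps is p :: ps' then [seq (p ^ l * n)%N | l <- iota 0 K, n <- smooth K ps'] else [:: 1%N].

Lemma smoothP K ps n : all prime ps -> n \in smooth K ps ->
  (0 < n)%N /\ forall q, prime q -> (q %| n)%N -> q \in ps.
Proof.
elim: ps n => [|p ps IH] n /=.
  by rewrite inE => _ /eqP ->; split=> // q pq; rewrite dvdn1 => /eqP q1; rewrite q1 in pq.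
move=> /andP[pp pps] /allpairsP[[l m] /= [_ /(IH _ pps)[m0 mP] ->]].
split; first by rewrite muln_gt0 expn_gt0 prime_gt0.
move=> q pq; rewrite inE Euclid_dvdM // => /orP[|/(mP _ pq) ->]; last by rewrite orbT.
by rewrite Euclid_dvdX // dvdn_prime2 // => /andP[->].
Qed.

Lemma smooth_uniq K ps : all prime ps -> uniq ps -> uniq (smooth K ps).
Proof.
elim: ps => [//|p ps IH] /= /andP[pp pps] /andP[pnps ups].
apply: allpairs_uniq; [exact: iota_uniq|exact: IH|].
have cop m : m \in smooth K ps -> (0 < m)%N /\ logn p m = 0%N.
  move=> /(smoothP pps)[m0 mP]; split=> //; apply/eqP; rewrite lognE pp m0 /=.
  by case: ifP => // /(mP _ pp) pps'; rewrite pps' in pnps.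
move=> [l m] [l' m'] /allpairsP[[a b] /= [_ bs [-> ->]]] /allpairsP[[c d] /= [_ ds [-> ->]]] e.
have [b0 lb] := cop _ bs; have [d0 ld] := cop _ ds.
have ac : a = c.
  have lE x y : (0 < y)%N -> logn p y = 0%N -> logn p (p ^ x * y) = x.
    by move=> y0 ly; rewrite lognM // ?expn_gt0 ?(prime_gt0 pp) // pfactorK // ly addn0.
  by have := congr1 (logn p) e; rewrite !lE.
by move: e; rewrite ac => /eqP; rewrite eqn_pmul2l ?expn_gt0 ?prime_gt0 // => /eqP ->.
Qed.

(** The exponents in n are less than n, so the cut-off K of the exponents is
harmless for n <= K. *)
Lemma mem_smooth K ps n : all prime ps -> uniq ps -> (0 < n)%N -> (n <= K)%N ->
  (forall q, prime q -> (q %| n)%N -> q \in ps) -> n \in smooth K ps.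
Proof.
elim: ps n => [|p ps IH] n /=.
  move=> _ _ n0 _ nP; rewrite inE; apply/negPn/negP => n1.
  have : (1 < n)%N by rewrite ltn_neqAle eq_sym n1.
  by move=> /pdiv_prime /nP /(_ (pdiv_dvd _)).
move=> /andP[pp pps] /andP[pnps ups] n0 nK nP.
apply/allpairsP; exists (logn p n, n %/ p ^ logn p n)%N => /=.
have nE : n = (p ^ logn p n * (n %/ p ^ logn p n))%N by rewrite mulnC divnK // pfactor_dvdnn.
have m0 : (0 < n %/ p ^ logn p n)%N by move: n0; rewrite {1}nE muln_gt0 => /andP[].
split=> //; first by rewrite mem_iota /= add0n (leq_trans (ltn_logl _ _)).
apply: IH => //; first by rewrite (leq_trans (leq_div _ _)).
move=> q pq qm; have := nP q pq; rewrite {1}nE dvdn_mull // inE => /(_ isT) /orP[/eqP qp|//].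
move: qm; rewrite qp => /(dvdn_mul (dvdnn (p ^ logn p n))).
by rewrite -nE -expnSr pfactor_dvdn // ltnn.
Qed.

(** Distributivity; p^l is coprime to the products of the other primes. *)
Lemma smooth_sum (K : nat) (A : comNzRingType) (f : nat -> A) (ps : seq nat) :
  f 1%N = 1 ->
  (forall m n, (0 < m)%N -> (0 < n)%N -> coprime m n -> f (m * n)%N = f m * f n) ->
  all prime ps -> uniq ps ->
  \sum_(n <- smooth K ps) f n = \prod_(p <- ps) \sum_(0 <= l < K) f (p ^ l)%N.
Proof.
move=> f1 fM; elim: ps => [|p ps IH] /=; first by rewrite big_seq1 big_nil.
move=> /andP[pp pps] /andP[pnps ups]; rewrite big_cons -IH // big_allpairs_dep.
rewrite /index_iota subn0 big_distrl /=; apply: eq_bigr => l _.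
rewrite big_distrr /=; apply: eq_big_seq => n /(smoothP pps)[n0 nP].
rewrite fM // ?expn_gt0 ?(prime_gt0 pp) //; case: l => [|l]; first by rewrite expn0 coprime1n.
rewrite coprime_pexpl // prime_coprime //.
by apply/negP => /(nP p pp) pps'; rewrite pps' in pnps.
Qed.

Variable R : realType.
Local Notation C := R[i].
Implicit Types f : nat -> C.

Lemma cvgC_prod (s : seq nat) (u : nat -> nat -> C) (l : nat -> C) :
  (forall p, p \in s -> u p @ \oo --> l p) ->
  (fun n => \prod_(p <- s) u p n) @ \oo --> \prod_(p <- s) l p.
Proof.
elim: s => [_|p s IH h].
  rewrite big_nil; apply: cvgC_eq (@cvgC_cst _ 1) => n; by rewrite big_nil.
rewrite big_cons; apply: (@cvgC_eq _ (fun n => u p n * \prod_(p <- s) u p n)).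
  by move=> n; rewrite big_cons.
apply: cvgC_M; first by apply: h; rewrite mem_head.
by apply: IH => q qs; apply: h; rewrite inE qs orbT.
Qed.

Lemma cvgC_le (u : nat -> C) (l c : C) (e : R) (N : nat) : u @ \oo --> l ->
  (forall n, (N <= n)%N -> normc (u n - c) <= e) -> normc (l - c) <= e.
Proof.
move=> ul ue; have h : (fun n => normc (u n - c)) @ \oo --> normc (l - c).
  exact: (cvgC_norm (cvgC_B ul (@cvgC_cst _ c))).
rewrite -(cvg_lim (@norm_hausdorff _ _) h); apply: limr_le; first by apply: cvgP h.
by exists N.
Qed.

(** The expansion of the product of the Euler factors over p < M, truncated at
exponents l < K with K >= M, contains every n < M exactly once, and otherwise
some integers n >= M, each at most once. So it differs from the partial sum up
to M by at most the tail of the series of absolute values; the bound survives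
the limit in K, and tends to 0 with M. *)
Lemma euler_product f (B : R) (F : nat -> C) (S : C) :
  f 1%N = 1 ->
  (forall m n, (0 < m)%N -> (0 < n)%N -> coprime m n -> f (m * n)%N = f m * f n) ->
  bounded_psum 1 f B ->
  (forall p, prime p -> csum 0 (fun l => f (p ^ l)%N) @ \oo --> F p) ->
  csum 1 f @ \oo --> S ->
  (fun M => \prod_(0 <= p < M | prime p) F p) @ \oo --> S.
Proof.
move=> f1 fM fB FP fS.
have anorm0 n : 0 <= anorm f n by exact: normc_ge0.
have rc : cvgn (rsum 1 (anorm f)) by apply: psum_cvg fB.
set T := limn (rsum 1 (anorm f)) in rc.
have tail : (fun M => T - rsum 1 (anorm f) M) @ \oo --> (0 : R).
  by rewrite -(subrr T); apply: cvgB => //; exact: cvg_cst.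
have key M : (0 < M)%N ->
    normc (\prod_(0 <= p < M | prime p) F p - csum 1 f M) <= T - rsum 1 (anorm f) M.
  move=> M0; pose ps := [seq p <- index_iota 0 M | prime p].
  have aps : all prime ps by rewrite filter_all.
  have ups : uniq ps by rewrite filter_uniq // iota_uniq.
  rewrite -big_filter -/ps.
  have cP : (fun K => \prod_(p <- ps) csum 0 (fun l => f (p ^ l)%N) K) @ \oo -->
      \prod_(p <- ps) F p.
    by apply: cvgC_prod => p; rewrite mem_filter => /andP[/FP].
  apply: (cvgC_le (N := M) cP) => K MK.
  rewrite /csum -smooth_sum // (bigID (fun n => (n < M)%N)) /=.
  have -> : \sum_(n <- smooth K ps | (n < M)%N) f n = \sum_(1 <= n < M) f n.
    rewrite -big_filter; apply: perm_big; apply: uniq_perm.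
    - by rewrite filter_uniq // smooth_uniq.
    - by rewrite iota_uniq.
    move=> n; rewrite mem_filter mem_index_iota andbC.
    case: (ltnP n M) => nM; rewrite ?andbF // !andbT.
    apply/idP/idP => [/(smoothP aps)[]//|n0].
    apply: mem_smooth => //; first by rewrite (leq_trans (ltnW nM)).
    move=> q pq qn; rewrite mem_filter pq mem_index_iota /=.
    by rewrite (leq_ltn_trans (dvdn_leq n0 qn)).
  rewrite addrAC subrr add0r (le_trans (le_normc_sum _ _ _)) //.
  (* N bounds the integers that occur in the expansion. *)
  pose N := (maxn M (\max_(n <- smooth K ps) n).+1)%N.
  have leN n : n \in smooth K ps -> (n < N)%N.
    by move=> ns; rewrite /N leq_max ltnS (@leq_bigmax_seq _ (smooth K ps) xpredT id n ns isT) orbT.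
  have -> : \sum_(i <- smooth K ps | ~~ (i < M)%N) normc (f i)
      = \sum_(M <= n < N | n \in smooth K ps) anorm f n.
    rewrite -big_filter -[RHS]big_filter; apply: perm_big; apply: uniq_perm.
    - by rewrite filter_uniq // smooth_uniq.
    - by rewrite filter_uniq // iota_uniq.
    move=> n; rewrite !mem_filter mem_index_iota -leqNgt andbC; case ns: (n \in _) => //=.
    by rewrite leN ?andbT.
  apply: (@le_trans _ _ (\sum_(M <= n < N) anorm f n)).
    by rewrite big_mkcond; apply: ler_sum => n _; case: ifP.
  rewrite lerBrDr addrC.
  have -> : rsum 1 (anorm f) M + \sum_(M <= n < N) anorm f n = rsum 1 (anorm f) N.
    by rewrite /rsum [RHS](big_cat_nat (n := M)) // leq_maxl.
  by apply: nondecreasing_cvgn_le => //; exact: psum_nondecreasing.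
have : (fun M => \prod_(0 <= p < M | prime p) F p - csum 1 f M) @ \oo --> (0 : C).
  apply/cvgC_dist; apply: (@squeeze_cvgr _ _ _ _ (fun=> 0) _ _ _ _ _ tail); last exact: cvg_cst.
  by exists 1%N => // M /= M0; rewrite normc_ge0 subr0 key.
move=> /cvgC_D /(_ fS); rewrite add0r; apply: cvgC_eq => M.
by rewrite subrK.
Qed.

End EulerProduct.

(** * The zeta series *)

Section ZetaSeries.
Variable R : realType.
Local Notation C := R[i].
Implicit Types (s w : C) (n M : nat).

Lemma anorm_npow s n : (0 < n)%N ->
  anorm (fun n => npow n (- s)) n = n%:R `^ (- complex.Re s).
Proof. by move=> n0; rewrite /anorm normc_npow //; case: s. Qed.

(** n^-e lies above its tangent at n + 1: with u = ln (n+1) - ln n, which is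
at least 1/(n+1), one has n^-e = (n+1)^-e e^(e u) >= (n+1)^-e (1 + e u). *)
Lemma powR_telescope (e : R) n : 0 < e -> (0 < n)%N ->
  e * n.+1%:R `^ (- (1 + e)) <= n%:R `^ (- e) - n.+1%:R `^ (- e).
Proof.
move=> e0 n0; have N0 : (0 : R) < n%:R by rewrite ltr0n.
have N1 : (0 : R) < n.+1%:R by rewrite ltr0n.
have lnE : n.+1%:R^-1 <= ln (n.+1%:R : R) - ln n%:R.
  have := @le_ln1Dx R (- n.+1%:R^-1).
  have -> : 1 + - n.+1%:R^-1 = n%:R / n.+1%:R :> R.
    by rewrite -natr1; field; rewrite natr1 gt_eqF.
  rewrite ln_div ?posrE // ltrN2 invf_lt1 // ltr1n ltnS => /(_ n0).
  by move=> h; rewrite -lerN2 opprB.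
rewrite /powR !gt_eqF // opprD mulrDl mulN1r expRD expRN lnK ?posrE //.
set a := ln n%:R in lnE *; set b := ln n.+1%:R in lnE *; set v := n.+1%:R^-1 in lnE *.
have -> : expR (- e * a) = expR (- e * b) * expR (e * (b - a)).
  by rewrite -expRD; congr expR; ring.
have h := expR_ge1Dx (e * (b - a)); have q0 := expR_gt0 (- e * b).
have h2 : e * v <= e * (b - a) by rewrite ler_pM2l.
rewrite mulrA lerBrDr -[X in _ + X]mul1r -mulrDl [leRHS]mulrC ler_pM2r //; lra.
Qed.

(** Telescoping of the previous inequality. *)
Lemma zeta_psum (e : R) M : 0 < e ->
  \sum_(1 <= n < M.+2) (n%:R : R) `^ (- (1 + e)) <= 1 + (1 - M.+1%:R `^ (- e)) / e.
Proof.
move=> e0; elim: M => [|M IH].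
  by rewrite big_nat1 !powR1 subrr mul0r addr0.
rewrite big_nat_recr //= (le_trans (lerD IH (lexx _))) //.
rewrite -addrA lerD2l -(ler_pM2l e0) mulrDr ![e * (_ / e)]mulrC !divfK ?gt_eqF //.
have := powR_telescope e0 (ltn0Sn M); lra.
Qed.

Lemma zeta_bounded s : 1 < complex.Re s ->
  bounded_psum 1 (fun n => npow n (- s)) (1 + (complex.Re s - 1)^-1).
Proof.
move=> s1 M; have e0 : 0 < complex.Re s - 1 by rewrite subr_gt0.
have h n : 0 <= anorm (fun n => npow n (- s)) n by exact: normc_ge0.
apply: (@le_trans _ _ (rsum 1 (anorm (fun n => npow n (- s))) M.+2)).
  by apply: psum_nondecreasing => //; lia.
rewrite /rsum (eq_big_nat _ _ (F2 := fun n => (n%:R : R) `^ (- (1 + (complex.Re s - 1))))).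
  by rewrite (le_trans (zeta_psum _ e0)) // lerD2l ler_pdivrMr // mulVf ?gt_eqF // gerBl powR_ge0.
by move=> n /andP[n0 _]; rewrite anorm_npow // addrC subrK.
Qed.

Lemma dirichlet_cvg (a : nat -> C) (B : R) s : bounded_psum 1 (fun n => a n * npow n (- s)) B ->
  csum 1 (fun n => a n * npow n (- s)) @ \oo --> dirichlet a s.
Proof. exact: bounded_psum_cvg. Qed.

Lemma zeta_cvg s : 1 < complex.Re s -> csum 1 (fun n => npow n (- s)) @ \oo --> zeta_series s.
Proof.
move=> s1; rewrite (_ : (fun n => _) = fun n => 1 * npow n (- s)).
  apply: (@dirichlet_cvg (fun=> 1) (1 + (complex.Re s - 1)^-1)).
  rewrite (_ : (fun n => _) = fun n => npow n (- s)); first exact: zeta_bounded.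
  by apply/funext => n; rewrite mul1r.
by apply/funext => n; rewrite mul1r.
Qed.

(** The terms with n >= 2 add up to at most sum n^-3 <= 1/2, taking e = 2
above. *)
Lemma zeta_series_neq0 s : 3 <= complex.Re s -> zeta_series s != 0.
Proof.
move=> s3; have s1 : 1 < complex.Re s by lra.
have : normc (zeta_series s - 1) <= 1 / 2.
  apply: (cvgC_le (N := 2) (zeta_cvg s1)) => M; case: M => [|[|M]] // _.
  rewrite /csum big_ltn // npow1n addrAC subrr add0r (le_trans (le_normc_sum _ _ _)) //.
  have := @zeta_psum 2 M (ltr0Sn _ _); rewrite big_ltn // powR1 lerD2l => h.
  have h0 : 0 <= (M.+1%:R : R) `^ (-2) by exact: powR_ge0.
  apply: (@le_trans _ _ (\sum_(2 <= i < M.+2) (i%:R : R) `^ (- (1 + 2)))); last by lra.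
  apply: ler_sum_nat => i /andP[i2 _].
  have := anorm_npow s (ltnW i2); rewrite /anorm => ->.
  rewrite ler_powR ?ler1n ?(ltnW i2) //; lra.
apply: contraTneq => ->; rewrite sub0r normc_opp normc1 -ltNge; lra.
Qed.

End ZetaSeries.

(** * Euler factors of the trace and L-series *)

Section LFunction.
Variable R : realType.
Local Notation C := R[i].
Implicit Types (s w q : C) (p n M l : nat).

Lemma geometric_cvg q : normc q < 1 -> csum 0 (fun l => q ^+ l) @ \oo --> (1 - q)^-1.
Proof.
move=> q1; have q0 : 1 - q != 0.
  by rewrite subr_eq0; apply: contraTneq q1 => <-; rewrite normc1 ltxx.
have c : (fun M => q ^+ M) @ \oo --> (0 : C).
  have h : (fun M => normc q ^+ M) @ \oo --> (0 : R).
    by apply: cvg_expr; rewrite ger0_norm // normc_ge0.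
  by apply: cvgC_squeeze h => M; rewrite subr0 normcX.
have := cvgC_M (cvgC_B (@cvgC_cst _ 1) c) (@cvgC_cst _ (1 - q)^-1).
rewrite subr0 mul1r; apply: cvgC_eq => M; apply: (mulIf q0); rewrite divfK //.
elim: M => [|M IH]; first by rewrite expr0 subrr /csum big_geq // mul0r.
by rewrite /csum big_nat_recr //= mulrDl -/(csum 0 (fun l => q ^+ l) M) -IH exprS; ring.
Qed.

Lemma powR_lt1 p (a : R) : prime p -> a < 0 -> p%:R `^ a < 1.
Proof.
move=> pp a0; rewrite /powR pnatr_eq0 eqn0Ngt prime_gt0 //=.
have l0 : 0 < ln (p%:R : R) by apply: ln_gt0; rewrite ltr1n prime_gt1.
by rewrite expR_lt1 pmulr_llt0.
Qed.

Lemma npow_neq1 p w : prime p -> complex.Re w < 0 -> 1 - npow p w != 0.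
Proof.
move=> pp w0; rewrite subr_eq0; apply/eqP => /(congr1 (@normc R)).
rewrite normc1 normc_npow ?prime_gt0 // => h.
by have := powR_lt1 pp w0; rewrite -h ltxx.
Qed.

Lemma finite_uniq_seq (A : set nat) : finite_set A -> exists2 s : seq nat, uniq s & A = [set` s].
Proof.
move=> /finite_seqP[s ->]; exists (undup s); first exact: undup_uniq.
by apply/seteqP; split=> p /=; rewrite mem_undup.
Qed.

(** The partial products become constant beyond the last element of A. *)
Lemma fsbig_prod_cvg (A : set nat) (g : nat -> bool) (F : nat -> C) : finite_set A ->
  (forall p, A p <-> prime p && ~~ g p) ->
  (fun M => \prod_(0 <= p < M | prime p) (if g p then 1 else F p))
    @ \oo --> \big[*%R/1]_(p \in A) F p.
Proof.
move=> fA gA; have [s us sA] := finite_uniq_seq fA.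
pose N := (\max_(p <- s) p).+1.
have NP p : prime p && ~~ g p -> p \in s /\ (p < N)%N.
  move=> /gA; rewrite sA => ps; split=> //.
  by rewrite ltnS; apply: (@leq_bigmax_seq _ s xpredT id p ps isT).
have E M : (N <= M)%N ->
    \prod_(0 <= p < M | prime p) (if g p then 1 else F p) = \big[*%R/1]_(p \in A) F p.
  move=> NM; rewrite sA -fsbig_seq //.
  transitivity (\prod_(0 <= p < M | prime p && ~~ g p) F p).
    by rewrite [RHS]big_mkcondr; apply: eq_bigr => p _; case: (g p).
  rewrite -big_filter; apply: perm_big; apply: uniq_perm => //.
    by rewrite filter_uniq // iota_uniq.
  move=> p; rewrite mem_filter mem_index_iota; apply/andP/idP => [[/NP[]//]|ps].
  have h : prime p && ~~ g p by apply/gA; rewrite sA.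
  by rewrite h; have [_ pN] := NP p h; rewrite (leq_trans pN).
apply: (cvg_trans _ (@cvgC_cst _ (\big[*%R/1]_(p \in A) F p))); apply: near_eq_cvg.
by exists N => // M /= NM; rewrite E.
Qed.

Variables (W : forall p : nat, weierstrass (padic_int p)) (t : nat -> int).
Hypothesis t_trace : is_trace_function W t.
Variable alpha : nat -> C.
Hypothesis alpha_eigen : frobenius_eigenvalues W t alpha.
Hypothesis bad_finite : finite_set (bad_primes W).

(** abs t(n) <= n bounds the terms by those of zeta(w - 1). *)
Lemma trace_term_bounded w : 2 < complex.Re w ->
  bounded_psum 1 (fun n => (t n)%:~R * npow n (- w)) (1 + (complex.Re (w - 1) - 1)^-1).
Proof.
move=> w2 M; have w1 : 1 < complex.Re (w - 1) by case: w w2 => a b /=; lra.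
apply: le_trans (zeta_bounded w1 M); apply: ler_sum_nat => n /andP[n0 _].
rewrite /anorm opprB npowD npow_1 // !normcM ler_wpM2r ?normc_ge0 //.
have -> : (t n)%:~R = ((t n)%:~R : R)%:C%C :> C by rewrite rmorph_int.
rewrite normc_real normc_nat -intr_norm.
have := trace_le t_trace n0; rewrite -(ler_nat R) => h.
by rewrite -abszE; exact: h.
Qed.

Lemma trace_cvg w : 2 < complex.Re w ->
  csum 1 (fun n => (t n)%:~R * npow n (- w)) @ \oo --> dirichlet (fun n => (t n)%:~R) w.
Proof. move=> w2; exact: dirichlet_cvg (trace_term_bounded w2). Qed.

(** The quotient of the Euler factors at p of T and of L. *)
Definition good_factor w p : C := if good_reduction (W p) then 1 - npow p (1 - 2%:R * w) else 1.

(** The formulas for t(p^l) hold for l > 0, whereas t(1) = 1. In the good case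
a^l + b^l is 2 at l = 0, and the series of 0^l, with sum 1, corrects the first
term; the bad cases are the geometric series of x, - x and 0. *)
Lemma trace_local_cvg w p : 2 < complex.Re w -> prime p ->
  csum 0 (fun l => (t (p ^ l))%:~R * npow (p ^ l) (- w)) @ \oo -->
  good_factor w p * local_factor W alpha p w.
Proof.
move=> w2 pp; have p0 := prime_gt0 pp; case: (t_trace) => t1 _ _.
rewrite /good_factor /local_factor; set x := npow p (- w).
have x1 : normc x < 1 by rewrite normc_npow // powR_lt1 //; case: w w2 {x} => a b /=; lra.
case: ifP => [good|/negbT bad].
  have [normA tA] := alpha_eigen pp good; set a := alpha p in normA tA *.
  have ca : a * conjc a = p%:R.
    rewrite -sqr_normc normA -rmorphXn sqr_sqrtr ?ler0n //; exact: natC.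
  have na : normc a = Num.sqrt p%:R by apply: complexI; rewrite -normE.
  have nca : normc (conjc a) = Num.sqrt p%:R.
    by apply: complexI; rewrite -normE normcJ.
  have px : p%:R * x = npow p (1 - w) by rewrite npowD npow_1.
  (* The square root of p is at most p, and p x = p^(1 - w) has absolute value less than 1. *)
  have small b : normc b = Num.sqrt p%:R -> normc (b * x) < 1.
    move=> nb; apply: (@le_lt_trans _ _ (normc (p%:R * x))).
      rewrite !normcM nb normc_nat ler_wpM2r ?normc_ge0 //.
      rewrite -[leRHS]ger0_norm // -sqrtr_sqr ler_wsqrtr // -natrX ler_nat.
      by rewrite -[leqLHS]muln1 leq_mul2l p0 orbT.
    by rewrite px normc_npow // powR_lt1 //; case: w w2 {x x1 px} => u v /=; lra.
  have n1 (b : C) : normc b < 1 -> 1 - b != 0.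
    by rewrite subr_eq0; apply: contraTneq => <-; rewrite normc1 ltxx.
  have sA := small a na; have sB := small (conjc a) nca.
  have s0 : normc (0 : C) < 1 by rewrite normc0.
  have c := cvgC_B (cvgC_D (geometric_cvg sA) (geometric_cvg sB)) (geometric_cvg s0).
  have -> : (1 - npow p (1 - 2%:R * w)) * ((1 - a * x) * (1 - conjc a * x))^-1 =
      (1 - a * x)^-1 + (1 - conjc a * x)^-1 - (1 - 0)^-1.
    have -> : npow p (1 - 2%:R * w) = (a * conjc a) * x ^+ 2.
      by rewrite npowD npow_1 // ca -npow_muln; congr (_ * npow p _); ring.
    by have := n1 _ sA; have := n1 _ sB => h1 h2; field; rewrite h1 h2.
  apply: cvgC_eq c => M; rewrite /csum -big_split -sumrB; apply: eq_bigr => l _ /=.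
  rewrite npowX // -/x !exprMn; case: l => [|l]; first by rewrite expn0 t1 !expr0; ring.
  rewrite expr0n /=.
  have := tA l.+1 isT; rewrite /pointN rmorphB rmorphD /= -pmulrn rmorph1 => e.
  have -> : (t (p ^ l.+1))%:~R = a ^+ l.+1 + conjc a ^+ l.+1 :> C.
    set T := _%:~R in e *; set X := _%:R in e.
    have -> : T = X + 1 - (X + 1 - T) by ring.
    by rewrite e; ring.
  by ring.
rewrite mul1r.
have tE l : (t (p ^ l))%:~R * npow (p ^ l) (- w) = (if split_reduction (W p) then x
    else if multiplicative_reduction (W p) then - x else 0) ^+ l.
  rewrite npowX // -/x; case: l => [|l]; first by rewrite expn0 t1 !expr0 mulr1.
  rewrite (trace_bad t_trace pp (ltn0Sn l) bad); case: ifP => _; first by rewrite mul1r.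
  case: ifP => _; last by rewrite mul0r expr0n.
  by rewrite [in RHS]exprNn rmorphXn /= rmorphN1.
have c (z : C) : normc z < 1 -> z = (if split_reduction (W p) then x
    else if multiplicative_reduction (W p) then - x else 0) ->
    csum 0 (fun l => (t (p ^ l))%:~R * npow (p ^ l) (- w)) @ \oo --> (1 - z)^-1.
  by move=> z1 zE; apply: cvgC_eq (geometric_cvg z1) => M; apply: eq_bigr => l _; rewrite tE zE.
move: c; case: ifP => _ c; first exact: c.
move: c; case: ifP => _ c; first by rewrite -{1}(opprK x); apply: c => //; rewrite normc_opp.
by have := c 0; rewrite subr0 invr1; apply => //; rewrite normc0.
Qed.

Lemma zeta_local_cvg s p : 1 < complex.Re s -> prime p ->
  csum 0 (fun l => npow (p ^ l) (- s)) @ \oo --> (1 - npow p (- s))^-1.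
Proof.
move=> s1 pp; have h : normc (npow p (- s)) < 1.
  by rewrite normc_npow ?prime_gt0 // powR_lt1 //; case: s s1 => a b /=; lra.
by apply: cvgC_eq (geometric_cvg h) => M; apply: eq_bigr => l _; rewrite npowX ?prime_gt0.
Qed.

Lemma bad_factor_cvg w :
  (fun M => \prod_(0 <= p < M | prime p)
      (if good_reduction (W p) then 1 else 1 - npow p (1 - 2%:R * w)))
    @ \oo --> bad_factor W w.
Proof.
apply: fsbig_prod_cvg => // p; rewrite /bad_primes.
by split=> [[pp ->]|/andP[]] //; rewrite pp.
Qed.

(** L_p is the product of the factor of T, of that of zeta(2w - 1), and, if p
is bad, of 1 - p^(1 - 2w). *)
Lemma L_product_eq w : 2 < complex.Re w ->
  L_product W alpha w =
    dirichlet (fun n => (t n)%:~R) w * (zeta_series (2%:R * w - 1) * bad_factor W w).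
Proof.
move=> w2; case: (t_trace) => t1 tM _.
have z1 : 1 < complex.Re (2%:R * w - 1) by case: w w2 => a b; rewrite -natC /=; lra.
have npM z m n : (0 < m)%N -> (0 < n)%N -> coprime m n -> npow (m * n) z = npow m z * npow n z :> C.
  by move=> m0 n0 _; rewrite npowM.
pose f n : C := (t n)%:~R * npow n (- w).
have f1 : f 1%N = 1 by rewrite /f t1 npow1n mulr1.
have fM m n : (0 < m)%N -> (0 < n)%N -> coprime m n -> f (m * n)%N = f m * f n.
  by move=> m0 n0 mn; rewrite /f tM // npowM // rmorphM /=; ring.
have c1 := euler_product f1 fM (trace_term_bounded w2)
  (fun p pp => trace_local_cvg w2 pp) (trace_cvg w2).
have c2 := euler_product (f := fun n => npow n (- (2%:R * w - 1))) (npow1n _) (npM _)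
   (zeta_bounded z1) (fun p pp => zeta_local_cvg z1 pp) (zeta_cvg z1).
have c := cvgC_M c1 (cvgC_M c2 (@bad_factor_cvg w)).
apply: cvg_lim; first exact: norm_hausdorff.
have E p : prime p -> good_factor w p * local_factor W alpha p w *
    ((1 - npow p (- (2%:R * w - 1)))^-1 *
     (if good_reduction (W p) then 1 else 1 - npow p (1 - 2%:R * w))) = local_factor W alpha p w.
  move=> pp; have y1 : 1 - npow p (1 - 2%:R * w) != 0.
    apply: npow_neq1 => //; move: z1 {c1 c2 c fM f1}; rewrite {}/f.
    by case: w {w2} => a b; rewrite -natC /=; lra.
  rewrite opprB /good_factor; case: (good_reduction (W p)); last by rewrite mul1r mulVf ?mulr1.
  by rewrite mulr1 mulrAC divff // mul1r.
apply: cvgC_eq c => M; rewrite -[X in _ * X]big_split -big_split.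
by apply: eq_bigr => p; exact: E.
Qed.

Lemma bad_factor_neq0 w : 2 < complex.Re w -> bad_factor W w != 0.
Proof.
move=> w2; have [s us sA] := finite_uniq_seq bad_finite.
rewrite /bad_factor sA -fsbig_seq // prodf_seq_neq0; apply/allP => p ps; apply/implyP => _.
have [pp _] : bad_primes W p by rewrite sA.
by apply: npow_neq1 => //; case: w w2 => a b; rewrite -natC /=; lra.
Qed.

End LFunction.

(** * Analytic functions and the identity theorem *)

Section Analytic.
Variable R : realType.
Local Notation C := R[i].
Implicit Types (g h : C -> C) (a z : C) (c : nat -> C).

Lemma nearC (P : C -> Prop) a :
  (\forall z \near a, P z) <-> exists2 r : R, 0 < r & forall z, normc (z - a) < r -> P z.
Proof.
split=> [/nbhs_ballP[e /= e0 eP]|[r r0 rP]].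
  case: e e0 eP => e i; rewrite ltcE /= => /andP[/eqP -> e0] eP.
  exists e => // z za; apply: eP; rewrite -ball_normE /ball_ /= normE normc_distC.
  by rewrite (ltcR _ e).
apply/nbhs_ballP; exists r%:C%C => /=; first by rewrite ltcR.
move=> z; rewrite -ball_normE /ball_ /= normE normc_distC ltcR; exact: rP.
Qed.

Lemma geometric_tail (x : R) m M : 0 <= x -> x <= 1 / 2 -> \sum_(m <= n < M) x ^+ n <= 2 * x ^+ m.
Proof.
move=> x0 x2; case: (leqP m M) => mM; last first.
  by rewrite big_geq ?(ltnW mM) // mulr_ge0 ?exprn_ge0.
suff : \sum_(m <= n < M) x ^+ n + 2 * x ^+ M <= 2 * x ^+ m.
  by apply: le_trans; rewrite lerDl mulr_ge0 ?exprn_ge0.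
elim: M mM => [|M IH]; first by rewrite leqn0 => /eqP ->; rewrite big_geq // add0r.
rewrite leq_eqVlt => /orP[/eqP ->|]; first by rewrite big_geq // add0r.
rewrite ltnS => mM; rewrite big_nat_recr //=; apply: le_trans (IH mM).
rewrite -addrA lerD2l exprS; have := exprn_ge0 M x0; nra.
Qed.

Definition power_terms c a z (n : nat) : C := c n * (z - a) ^+ n.

(** An expansion at a, together with a geometric bound on its coefficients and
a radius r so small that on the disk the terms are at most B / 2^n. *)
Definition expansion g a c (B K r : R) : Prop :=
  [/\ 0 < K, 0 < r, K * r <= 1 / 2, forall n, normc (c n) <= B * K ^+ n
    & forall z, normc (z - a) < r -> csum 0 (power_terms c a z) @ \oo --> g z].

Lemma cvgC_bounded (u : nat -> C) (l : C) : u @ \oo --> l -> exists B, forall n, normc (u n) <= B.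
Proof.
move=> /cvgC_norm ul; have [B BP] := cvg_has_ub (cvgP _ ul).
by exists B => n; rewrite -[leLHS]ger0_norm ?normc_ge0 //; apply: BP; exists n.
Qed.

(** If the series converges on a disk of radius r0, then its terms at distance
r0/2 from a are bounded, by 2 B if B bounds the partial sums, whence
abs(c n) <= 2 B (2/r0)^n. *)
Lemma analytic_expansion g a : analytic_at g a -> exists c B K r, expansion g a c B K r.
Proof.
move=> [c /nearC[r0 r00 cg]]; pose z0 := a + (r0 / 2)%:C%C.
have z0a : normc (z0 - a) = r0 / 2.
  by rewrite /z0 addrC addKr normc_real ger0_norm // divr_ge0 // ltW.
have [|B BP] := @cvgC_bounded (csum 0 (power_terms c a z0)) (g z0).
  by apply: cg; rewrite z0a; lra.
exists c, (B + B), (2 / r0), (r0 / 4); split; rewrite ?divr_gt0 //.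
- by have -> : 2 / r0 * (r0 / 4) = 1 / 2 by field; rewrite gt_eqF.
- move=> n; have p0 : 0 < (r0 / 2) ^+ n by rewrite exprn_gt0 // divr_gt0.
  rewrite -(ler_pM2r p0) -mulrA -exprMn.
  have -> : 2 / r0 * (r0 / 2) = 1 by field; rewrite gt_eqF.
  rewrite expr1n mulr1 -z0a -normcX -normcM -/(power_terms c a z0 n).
  have -> : power_terms c a z0 n = csum 0 (power_terms c a z0) n.+1 - csum 0 (power_terms c a z0) n.
    by rewrite /csum big_nat_recr //= addrAC subrr add0r.
  by rewrite (le_trans (normc_triangle _ _)) // normc_opp lerD.
by move=> z za; apply: cg; apply: lt_le_trans za _; lra.
Qed.

Lemma expansion_term g a c B K r z n : expansion g a c B K r -> normc (z - a) < r ->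
  normc (power_terms c a z n) <= B * (K * normc (z - a)) ^+ n.
Proof.
move=> [K0 r0 Kr cB cg] za; rewrite /power_terms normcM normcX exprMn mulrA.
by rewrite ler_wpM2r ?exprn_ge0 ?normc_ge0.
Qed.

Lemma expansion_tail g a c B K r z m M : expansion g a c B K r -> normc (z - a) < r ->
  rsum m (anorm (power_terms c a z)) M <= B * (2 * (K * normc (z - a)) ^+ m).
Proof.
move=> e za; have [K0 r0 Kr cB cg] := e.
have B0 : 0 <= B by have := cB 0%N; rewrite expr0 mulr1; apply: le_trans; exact: normc_ge0.
have n0 := normc_ge0 (z - a).
apply: (@le_trans _ _ (B * \sum_(m <= n < M) (K * normc (z - a)) ^+ n)).
  by rewrite mulr_sumr; apply: ler_sum => n _; exact: (expansion_term n e za).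
rewrite ler_wpM2l // geometric_tail ?mulr_ge0 ?(ltW K0) //.
by apply: le_trans Kr; rewrite ler_pM2l // ltW.
Qed.

Lemma expansion_bounded g a c B K r z : expansion g a c B K r -> normc (z - a) < r ->
  bounded_psum 0 (power_terms c a z) (B * 2).
Proof. by move=> e za M; have := expansion_tail 0 M e za; rewrite expr0 mulr1. Qed.

Lemma analytic_cst k a : analytic_at (fun=> k) a.
Proof.
exists (fun n => if n == 0%N then k else 0); apply/nearC; exists 1 => // z _.
have h : normc (0 : C) < 1 by rewrite normc0.
have := cvgC_M (@cvgC_cst _ k) (geometric_cvg h); rewrite subr0 invr1 mulr1.
apply: cvgC_eq => M; rewrite /csum mulr_sumr; apply: eq_bigr => n _.
by rewrite expr0n; case: n => [|n]; rewrite ?mulr0 ?mul0r // expr0.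
Qed.

Lemma analyticD g h a : analytic_at g a -> analytic_at h a -> analytic_at (fun z => g z + h z) a.
Proof.
move=> [c /nearC[r r0 cg]] [d /nearC[r' r0' dh]]; exists (fun n => c n + d n).
apply/nearC; exists (Num.min r r'); first by rewrite lt_min r0.
move=> z; rewrite lt_min => /andP[zr zr'].
apply: cvgC_eq (cvgC_D (cg z zr) (dh z zr')) => M.
by rewrite -big_split; apply: eq_bigr => n _; rewrite mulrDl.
Qed.

Lemma analyticM g h a : analytic_at g a -> analytic_at h a -> analytic_at (fun z => g z * h z) a.
Proof.
move=> /analytic_expansion[c [B [K [r e]]]] /analytic_expansion[d [B' [K' [r' e']]]].
have [_ r0 _ _ cg] := e; have [_ r0' _ _ dh] := e'.
exists (convolution c d); apply/nearC; exists (Num.min r r'); first by rewrite lt_min r0.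
move=> z; rewrite lt_min => /andP[zr zr'].
have := cvg_convolution (expansion_bounded e zr) (expansion_bounded e' zr') (cg z zr) (dh z zr').
apply: cvgC_eq => M; apply: eq_bigr => n _; rewrite /convolution mulr_suml.
apply: eq_bigr => i _; rewrite /power_terms.
have -> : (z - a) ^+ n = (z - a) ^+ i * (z - a) ^+ (n - i).
  by rewrite -exprD subnKC // -ltnS.
ring.
Qed.

Lemma analytic_opp g a : analytic_at g a -> analytic_at (fun z => - g z) a.
Proof.
move=> ga; have := analyticM (@analytic_cst (-1) a) ga.
by rewrite (_ : (fun z => -1 * g z) = fun z => - g z) //; apply/funext => z; rewrite mulN1r.
Qed.

Lemma analytic_affine g k b a : analytic_at g (k * a + b) -> analytic_at (fun z => g (k * z + b)) a.
Proof.
move=> [c /nearC[r r0 cg]]; exists (fun n => c n * k ^+ n); apply/nearC.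
have k0 : 0 < normc k + 1 by have := normc_ge0 k; lra.
exists (r / (normc k + 1)); first by rewrite divr_gt0.
move=> z; rewrite ltr_pdivlMr // => za.
have zE : k * z + b - (k * a + b) = k * (z - a) by ring.
apply: cvgC_eq (cg (k * z + b) _) => [M|].
  by apply: eq_bigr => n _; rewrite zE exprMn mulrA.
rewrite zE normcM mulrC (le_lt_trans _ za) // ler_wpM2l ?normc_ge0 //; lra.
Qed.

Lemma analytic_shift g b a : analytic_at g (a + b) -> analytic_at (fun z => g (z + b)) a.
Proof.
have -> : (fun z => g (z + b)) = (fun z => g (1 * z + b)).
  by apply/funext => z; rewrite mul1r.
by move=> h; apply: analytic_affine; rewrite mul1r.
Qed.

Lemma analytic_npow p k b a : analytic_at (fun z => npow p (k * z + b)) a.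
Proof.
pose l : C := k * (ln p%:R)%:C%C.
exists (fun n => npow p (k * a + b) * (l ^+ n / n`!%:R)); apply/nearC; exists 1 => // z _.
have -> : npow p (k * z + b) = npow p (k * a + b) * cexp (l * (z - a)).
  have -> : k * z + b = (k * a + b) + k * (z - a) by ring.
  by rewrite npowD /npow /l; congr (_ * cexp _); ring.
apply: cvgC_eq (cvgC_M (@cvgC_cst _ (npow p (k * a + b))) (@cexp_cvg _ (l * (z - a)))) => M.
rewrite /csum mulr_sumr; apply: eq_bigr => n _; rewrite /exp_term exprMn; ring.
Qed.

Definition zeros_cluster g a : Prop :=
  forall e : R, 0 < e -> exists z, [/\ 0 < normc (z - a), normc (z - a) < e & g z = 0].

(** If the coefficients before the k-th vanish, then at a zero z of g at
distance x from a the k-th term is at most the tail that follows it: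
abs(c k) x^k <= 2 B (K x)^(k+1). As x can be taken arbitrarily small, c k = 0
as well. *)
Lemma isolated_zeros g a : analytic_at g a -> zeros_cluster g a ->
  exists2 r, 0 < r & forall z, normc (z - a) < r -> g z = 0.
Proof.
move=> /analytic_expansion[c [B [K [r e]]]] acc; have [K0 r0 Kr cB cg] := e.
suff c0 n : c n = 0.
  exists r => // z za; apply: (cvgC_unique (cg z za)).
  apply: cvgC_eq (@cvgC_cst _ 0) => M; rewrite /csum big1 // => n _.
  by rewrite /power_terms c0 mul0r.
elim/ltn_ind: n => k IH; apply/eqP/negPn/negP => ck.
have ck0 : 0 < normc (c k) by rewrite normc_gt0.
have B0 : 0 <= B by have := cB 0%N; rewrite expr0 mulr1; apply: le_trans; exact: normc_ge0.
(* A zero at distance less than abs(c k) / D from a contradicts the bound on c k;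
   the summand 1 makes D positive. *)
pose D := B * (2 * K ^+ k.+1) + 1.
have D0 : 0 < D by rewrite ltr_wpDl // mulr_ge0 // mulr_ge0 // exprn_ge0 // ltW.
have [|z [z0 ze gz]] := acc (Num.min r (normc (c k) / D)); first by rewrite lt_min r0 divr_gt0.
move: ze; rewrite lt_min ltr_pdivlMr // => /andP[zr zD].
have : normc (g z - c k * (z - a) ^+ k) <= B * (2 * (K * normc (z - a)) ^+ k.+1).
  apply: (cvgC_le (N := k.+1) (cg z zr)) => M kM.
  rewrite /csum (big_cat_nat (n := k.+1)) //= big_nat_recr //= big1_seq; last first.
    by move=> i /andP[_]; rewrite mem_index_iota => /andP[_ ik]; rewrite /power_terms IH // mul0r.
  rewrite add0r -/(power_terms c a z k) addrAC subrr add0r (le_trans (le_normc_sum _ _ _)) //.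
  exact: (expansion_tail k.+1 M e zr).
rewrite gz sub0r normc_opp normcM normcX exprMn.
set x := normc (z - a) in z0 zD *; have xk : 0 < x ^+ k by rewrite exprn_gt0.
rewrite (_ : B * _ = (B * (2 * K ^+ k.+1) * x) * x ^+ k); last by rewrite (exprS x); ring.
rewrite ler_pM2r // leNgt; apply/negP/negPn; apply: le_lt_trans zD.
by rewrite /D mulrDr mulr1 [leLHS]mulrC lerDl ltW.
Qed.

(** The set of the points of U where zeros of g accumulate is open in U, since
by [isolated_zeros] g vanishes around such a point. It is also closed, since
accumulation points of accumulation points of zeros are accumulation points of
zeros. This avoids re-expanding power series at other points. *)
Lemma identity_theorem g (U : set C) (tau : R) :
  connected U -> (forall a, U a -> analytic_at g a) ->
  (forall s, tau < complex.Re s -> U s /\ g s = 0) -> forall s, U s -> g s = 0.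
Proof.
move=> Uc Ua Ug.
have flat_acc a r : 0 < r -> (forall z, normc (z - a) < r -> g z = 0) -> zeros_cluster g a.
  move=> r0 gr e e0; pose d := Num.min r e / 2.
  have d0 : 0 < d by rewrite divr_gt0 // lt_min r0.
  have za : normc (a + d%:C%C - a) = d by rewrite addrC addKr normc_real gtr0_norm.
  have : d < Num.min r e by rewrite ltr_pdivrMr // mulrDr mulr1 ltrDl lt_min r0.
  rewrite lt_min => /andP[dr de]; exists (a + d%:C%C).
  by rewrite za; split=> //; apply: gr; rewrite za.
suff accU : U `&` zeros_cluster g = U.
  move=> s Us; have [_ acc] : (U `&` zeros_cluster g) s by rewrite accU.
  have [r r0 gr] := isolated_zeros (Ua s Us) acc.
  by apply: gr; rewrite subrr normc0.
apply: Uc.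
- pose s0 : C := (tau + 1)%:C%C; exists s0; split; first by have [] := Ug s0; rewrite //= ltrDl.
  apply: (@flat_acc s0 1) => // z zs; have [] := Ug z => //.
  have := le_lt_trans (normc_ge_Re _) zs; rewrite ltr_norml => /andP[].
  by case: z {zs} => u v /=; lra.
(* Open: points around which g vanishes identically. *)
- exists [set a | exists2 r, 0 < r & forall z, normc (z - a) < r -> g z = 0].
    rewrite openE => a [r r0 gr]; apply/nearC; exists (r / 2); first by rewrite divr_gt0.
    move=> b ba; exists (r / 2); first by rewrite divr_gt0.
    move=> z zb; apply: gr; rewrite -(subrK b z) -addrA.
    by apply: le_lt_trans (normc_triangle _ _) _; lra.
  apply/seteqP; split=> a [Ua_ h]; split=> //; first exact: (isolated_zeros (Ua a Ua_) h).
  by case: h => r r0 gr; exact: flat_acc gr.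
(* Closed: a zero close enough to an accumulation point b of zeros near a is near a and is not a. *)
exists (zeros_cluster g) => // a h e e0.
have nb : \forall b \near a, normc (b - a) < e / 2.
  by apply/nearC; exists (e / 2) => //; rewrite divr_gt0.
have [b [bacc ba]] := h _ nb.
have [ab|ab] := eqVneq b a; first by rewrite -ab; exact: bacc.
have ab0 : 0 < normc (b - a) by rewrite normc_gt0 subr_eq0.
have [|z [z0 zb gz]] := bacc (Num.min (normc (b - a)) (e / 2)).
  by rewrite lt_min ab0 divr_gt0.
move: zb; rewrite lt_min => /andP[zb1 zb2].
exists z; split=> //.
  rewrite normc_gt0 subr_eq0; apply: contraTneq zb1 => ->.
  by rewrite normc_distC ltxx.
rewrite -(subrK b z) -addrA; apply: le_lt_trans (normc_triangle _ _) _.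
by rewrite /=; move: ba => /= ba; lra.
Qed.

End Analytic.

(** * The logarithmic derivative *)

Section Main.
Variable R : realType.
Local Notation C := R[i].
Variables (W : forall p : nat, weierstrass (padic_int p)) (t : nat -> int).
Hypothesis t_trace : is_trace_function W t.
Variable alpha : nat -> C.
Hypothesis alpha_eigen : frobenius_eigenvalues W t alpha.
Hypothesis bad_finite : finite_set (bad_primes W).
Implicit Types s w : C.

(** N(n) n^-(s+1) = n^-s + n^-(s+1) - t(n) n^-(s+1). *)
Lemma dirichlet_pointN s : 1 < complex.Re s ->
  dirichlet (fun n => (pointN t n)%:~R) (s + 1) =
    zeta_series (s + 1) + zeta_series s - dirichlet (fun n => (t n)%:~R) (s + 1) :> C.
Proof.
move=> s1; have s2 : 2 < complex.Re (s + 1) by case: s s1 => a b /=; lra.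
have s1' : 1 < complex.Re (s + 1) by lra.
have c := cvgC_B (cvgC_D (zeta_cvg s1') (zeta_cvg s1)) (trace_cvg t_trace s2).
apply: cvg_lim; first exact: norm_hausdorff.
apply: cvgC_eq c => M; rewrite /csum -big_split -sumrB; apply: eq_big_nat => n /andP[n0 _] /=.
have -> : npow n (- s) = n%:R * npow n (- (s + 1)).
  by rewrite -npow_1 // -npowD; congr npow; ring.
rewrite /pointN rmorphB rmorphD /= -pmulrn; ring.
Qed.

(** The nonvanishing of the denominator is part of the conclusion because it
is what allows the identity to be multiplied out before it is continued. *)
Lemma log_derivative_half_plane (sigma : R) (Z : C -> C) s :
  is_modified_zeta t sigma Z -> sigma < complex.Re s -> 1 < complex.Re s ->
  [/\ derive1 Z s / Z s = - zeta_series (s + 1) - zeta_series s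
       + L_product W alpha (s + 1)
           / (zeta_series (2%:R * s + 1) * bad_factor W (s + 1))
    & zeta_series (2%:R * s + 1) * bad_factor W (s + 1) != 0].
Proof.
move=> ZP s_sigma s1; have s2 : 2 < complex.Re (s + 1) by case: s s1 {s_sigma} => a b /=; lra.
have n0 : zeta_series (2%:R * s + 1) * bad_factor W (s + 1) != 0.
  rewrite mulf_neq0 ?bad_factor_neq0 // zeta_series_neq0 //.
  by case: s s1 {s_sigma s2} => a b; rewrite -natC /=; lra.
split=> //; have [_ _ ->] := ZP s s_sigma.
rewrite dirichlet_pointN // (L_product_eq t_trace alpha_eigen bad_finite s2).
have -> : 2%:R * (s + 1) - 1 = 2%:R * s + 1 by ring.
by rewrite mulfK //; ring.
Qed.

Lemma analytic_bad_factor (a : C) : analytic_at (fun z => bad_factor W (z + 1)) a.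
Proof.
have [l ul lE] := finite_uniq_seq bad_finite.
have -> : (fun z => bad_factor W (z + 1)) =
    fun z : C => \prod_(p <- l) (1 - npow p (1 - 2%:R * (z + 1))).
  by apply/funext => z; rewrite /bad_factor lE -fsbig_seq.
elim: l {ul lE} => [|p l IH].
  have -> : (fun z : C => \prod_(p <- [::]) (1 - npow p (1 - 2%:R * (z + 1)))) = fun=> 1.
    by apply/funext => z; rewrite big_nil.
  exact: analytic_cst.
have -> : (fun z : C => \prod_(q <- p :: l) (1 - npow q (1 - 2%:R * (z + 1)))) =
    fun z => (1 - npow p (- 2%:R * z + - 1)) * \prod_(q <- l) (1 - npow q (1 - 2%:R * (z + 1))).
  by apply/funext => z; rewrite big_cons; congr ((1 - npow p _) * _); ring.
apply: analyticM IH; apply: analyticD; first exact: analytic_cst.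
by apply: analytic_opp; exact: analytic_npow.
Qed.

End Main.

Theorem theorem5p7 (R : realType)
    (E : weierstrass rat) (E_elliptic : is_elliptic E)
    (W : forall p : nat, weierstrass (padic_int p))
    (W_minimal : forall p, prime p -> minimal_model E (W p))
    (t : nat -> int) (t_trace : is_trace_function W t)
    (alpha : nat -> R[i]) (alpha_eigen : frobenius_eigenvalues W t alpha)
    (sigma : R) (Z : R[i] -> R[i]) (Z_zeta : is_modified_zeta t sigma Z) :
  (forall s : R[i], sigma < complex.Re s -> 1 < complex.Re s ->
     derive1 Z s / Z s =
       - zeta_series (s + 1) - zeta_series s
       + L_product W alpha (s + 1)
           / (zeta_series (2%:R * s + 1) * bad_factor W (s + 1)))
  /\
  (forall (zeta L D : R[i] -> R[i]) (U V : set R[i]),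
     analytic_continuation (@zeta_series R) (~` [set 1]) zeta ->
     analytic_continuation (L_product W alpha) V L ->
     analytic_continuation (fun s => derive1 Z s / Z s) U D ->
     (forall s, U s -> [/\ s != 0, s != 1 & V (s + 1)]) ->
     forall s, U s -> zeta (2%:R * s + 1) * bad_factor W (s + 1) != 0 ->
       D s =
         - zeta (s + 1) - zeta s
         + L (s + 1) / (zeta (2%:R * s + 1) * bad_factor W (s + 1))).
Proof.
have bad_finite := bad_primes_finite E_elliptic W_minimal.
have half_plane := log_derivative_half_plane t_trace alpha_eigen bad_finite Z_zeta.
split=> [s h1 h2|zeta L D U V]; first by have [] := half_plane s h1 h2.
move=> [_ _ zeta_an [sz zetaE]] [_ _ L_an [sL LE]] [_ Uc D_an [sD DE]] UP s Us n0.
(* M z is the denominator, and G z the difference of the two sides multiplied by it. *)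
pose M (z : R[i]) : R[i] := zeta (2%:R * z + 1) * bad_factor W (z + 1).
pose G (z : R[i]) : R[i] := (D z + (zeta (z + 1) + zeta z)) * M z - L (z + 1).
have G_an a : U a -> analytic_at G a.
  move=> Ua; have [a0 a1 Va] := UP a Ua; rewrite /G /M.
  apply: analyticD; last by apply: analytic_opp; apply: analytic_shift; exact: L_an.
  apply: analyticM.
    apply: analyticD; first exact: D_an.
    apply: analyticD; last by apply: zeta_an; exact/eqP.
    by apply: analytic_shift; apply: zeta_an => /= /eqP; rewrite -subr_eq0 addrK (negbTE a0).
  apply: analyticM; last exact: analytic_bad_factor.
  apply: (@analytic_affine R zeta 2%:R 1); apply: zeta_an => /= /eqP.
  by rewrite -subr_eq0 addrK mulf_eq0 pnatr_eq0 (negbTE a0).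
pose tau := `|sz| + `|sL| + `|sD| + `|sigma| + 1.
have G0 z : tau < complex.Re z -> U z /\ G z = 0.
  have := ler_norm sz; have := ler_norm sL; have := ler_norm sD; have := ler_norm sigma.
  have := normr_ge0 sz; have := normr_ge0 sL; have := normr_ge0 sD; have := normr_ge0 sigma.
  rewrite /tau => p1 p2 p3 p4 q1 q2 q3 q4 zt.
  have [Uz Dz] : U z /\ D z = derive1 Z z / Z z by apply: DE; lra.
  split=> //; have [] := half_plane z; [by lra|by lra|rewrite -Dz /G /M].
  have zE u : sz < complex.Re u -> zeta u = zeta_series u by move=> /zetaE[].
  have -> : zeta (z + 1) = zeta_series (z + 1) by apply: zE; case: z zt {Uz Dz} => u v /=; lra.
  have -> : zeta z = zeta_series z by apply: zE; lra.
  have -> : zeta (2%:R * z + 1) = zeta_series (2%:R * z + 1).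
    by apply: zE; case: z zt {Uz Dz} => u v; rewrite -natC /=; lra.
  have -> : L (z + 1) = L_product W alpha (z + 1).
    by have [] := LE (z + 1) => //; case: z zt {Uz Dz} => u v /=; lra.
  move=> ->; set P := zeta_series _ * bad_factor _ _ => P0; set l := L_product _ _ _.
  rewrite (_ : _ + (_ + _) = l / P); last by ring.
  by rewrite divfK // subrr.
have := identity_theorem Uc G_an G0 Us; rewrite /G /M => /eqP; rewrite subr_eq0 => /eqP <-.
by rewrite mulfK //; ring.
Qed.
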